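(* Let $k\ge 0$ be an integer. Then $$\xi_k(1)=\frac{(2k-1)!!}{(4\sqrt{\pi})^k},$$ and for every integer $n\ge 1$, $$\xi_k(2n+1)=(-1)^{kn+1}\pi^{-\frac{2n+k}{2}}\,\frac{(2n+1)!\,2n}{4^n\cdot n!}\left(\frac{4^{n-1}(n!)^2}{(2n)!}\right)^k(2k-3)!!\;\zeta(2n+1)$$ and $$\xi_k(2n)=(-1)^{kn}\pi^{-\frac{2n+k}{2}}\,2n(2n-1)\,(n-1)!\left(\frac{(2n)!}{4^n\,n!\,(n-1)!}\right)^k Z_k(2n).$$
   Context: Let $\zeta$ be the Riemann zeta function, $\chi(s)=2^s\pi^{s-1}\sin(\pi s/2)\Gamma(1-s)$ (so $\zeta(s)=\chi(s)\zeta(1-s)$), and $$\omega(s)=\frac{\chi'}{\chi}(s)=\log 2\pi-\frac{\Gamma'}{\Gamma}(s)+\frac{\pi}{2}\tan\frac{\pi s}{2}.$$ The meromorphic functions $Z_k$ are defined recursively by $Z_0(s)=\zeta(s)$ and $Z_{k+1}(s)=Z_k'(s)-\frac12\omega(s)Z_k(s)$ for $k\ge 0$. For $k\ge 0$ define $$\xi_k(s)=\pi^{-\frac{s}{2}}\,s(s-1)\,\frac{Z_k(s)}{\Gamma\left(\frac{s}{2}\right)^{k-1}\Gamma\left(\frac{1-s}{2}\right)^k},$$ which is an entire function (after filling in removable singularities; its values at points such as $s=2n+1$ are those of the entire extension). Here $(2k-1)!!=\prod_{l=1}^k(2l-1)$ for $k\ge 1$, with the conventions $(-1)!!=1$ and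 $(-3)!!=-1$. *)

(* Defs.v *)
(* The complex plane is R[i], for an arbitrary R : realType. *)
From HB Require Import structures.
From mathcomp Require Import all_boot all_order all_algebra.
From mathcomp Require Import complex.
From mathcomp Require Import all_classical all_reals all_analysis.

Set Implicit Arguments.
Unset Strict Implicit.
Unset Printing Implicit Defensive.

Import Order.TTheory GRing.Theory Num.Theory.
Import numFieldNormedType.Exports.

Local Open Scope classical_set_scope.
Local Open Scope ring_scope.
Local Open Scope complex_scope.

Section ComplexFunctions.
Context {R : realType}.
Implicit Types (s z : R[i]) (f : R[i] -> R[i]).
Local Notation Re := (@complex.Re R).
Local Notation Im := (@complex.Im R).

(* The topology of the complex plane is the one carried by R[i]^o. *)

Definition cderiv f s : R[i] := derive1 (f : R[i] -> R[i]^o) s.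

Definition punctured (f : R[i] -> R[i]) s : set_system R[i]^o :=
  (f z : R[i]^o) @[z --> (s : R[i]^o)^'].

Definition cintegral (D : set R) (g : R -> R[i]) : R[i] :=
  Rintegral lebesgue_measure D (fun t => Re (g t)) +i*
  Rintegral lebesgue_measure D (fun t => Im (g t)).

Definition cexp z : R[i] :=
  (expR (Re z))%:C * (cos (Im z) +i* sin (Im z)).

(* t ^ s for real t > 0 *)
Definition cpow (t : R) s : R[i] := cexp (s * (ln t)%:C).

Definition csin z : R[i] := (cexp ('i * z) - cexp (- ('i * z))) / (2 * 'i).
Definition ccos z : R[i] := (cexp ('i * z) + cexp (- ('i * z))) / 2.
Definition ctan z : R[i] := csin z / ccos z.

(* Gamma, by Euler's integral when Re s > 0 *)
Definition Gamma_right s : R[i] :=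
  cintegral `]0, +oo[ (fun t => cpow t (s - 1) * (expR (- t))%:C).

(* ... and continued to the left by
   Gamma(s) = Gamma(s + m) / (s (s + 1) ... (s + m - 1)), where m is the least
   natural number such that Re s + m > 0.  The value at a pole is 0. *)
Definition Gamma s : R[i] :=
  let m := if 0 < Re s then 0%N else (Num.truncn (- Re s)).+1 in
  Gamma_right (s + m%:R) / \prod_(j < m) (s + j%:R).

Definition chi s : R[i] :=
  cpow 2 s * cpow pi (s - 1) * csin (pi%:C * s / 2) * Gamma (1 - s).

(* The zeta function on the half-plane Re s > 0: the Dirichlet series for
   Re s > 1, and its continuation
   zeta(s) = s / (s - 1) - s \int_1^oo {x} x^(- s - 1) dx for 0 < Re s <= 1. *)
Definition zeta_right s : R[i] :=
  if 1 < Re s then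
    limn (series (fun n => cpow n.+1%:R (- s)) : (R[i]^o)^nat)
  else
    s / (s - 1) -
    s * cintegral `[1, +oo[
          (fun x => (x - (Num.floor x)%:~R)%:C * cpow x (- s - 1)).

(* The continuation to the whole plane, by the functional equation; at s = 0
   the right-hand side chi(s) zeta(1 - s) has a removable singularity.
   The value at the pole s = 1 is irrelevant. *)
Definition zeta s : R[i] :=
  if 0 < Re s then zeta_right s
  else if s == 0 then - 2^-1
  else chi s * zeta_right (1 - s).

Definition omega s : R[i] :=
  (ln (2 * pi))%:C - cderiv Gamma s / Gamma s
  + pi%:C / 2 * ctan (pi%:C * s / 2).

Fixpoint Z (k : nat) : R[i] -> R[i] :=
  if k is k'.+1 then fun s => cderiv (Z k') s - 2^-1 * omega s * Z k' s
  else zeta.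

(* xi_k, wherever all the factors are finite; the exponent k - 1 is -1
   when k = 0. *)
Definition xi_formula (k : nat) s : R[i] :=
  cpow pi (- s / 2) * s * (s - 1) *
  (Z k s / (Gamma (s / 2) ^ (k%:Z - 1) * Gamma ((1 - s) / 2) ^+ k)).

(* The extension of xi_k over its removable singularities.  This is meaningful
   at s when xi_formula k z has a finite limit as z tends to s, z <> s. *)
Definition xi (k : nat) s : R[i] := lim (punctured (xi_formula k) s).

End ComplexFunctions.

(* odd_dfact k is (2k - 1)!!; on negative integers only k = -1 is used, with
   the convention (-3)!! = -1. *)
Definition odd_dfact (k : int) : int :=
  match k with
  | Posz m => (\prod_(1 <= l < m.+1) (2 * l - 1))%N%:Z
  | Negz _ => -1
  end.

(* Main.v *)
(* The recursion Z_(k+1) = Z_k' - omega Z_k / 2 is local, so everything follows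
   from the Laurent behaviour of zeta and omega at the point s0.  At s0 = 2n both
   are holomorphic, hence so is Z_k, and xi_k(2n) is obtained by evaluating the
   formula with the classical values of Gamma.  At an odd s0, tan(pi s / 2) gives
   omega a simple pole of residue -1; if zeta has a pole of order m there (m = 1
   at s0 = 1, m = 0 otherwise), Z_k has one of order m + k, and each step
   multiplies its leading coefficient by 1/2 - (m + j), which produces the double
   factorial.  The simple pole of Gamma((1 - s) / 2) at s0, taken to the power k,
   and the factor s - 1 when m = 1, cancel this pole exactly.

   Instead of power series, holomorphy at s0 is used in the form "complex
   differentiable n times near s0, for all n".  Gamma, the zeta integral and
   (e^w - 1) / w are all Laplace transforms of the form
   \int_D w(t) e^(s u(t)) dt, which can be differentiated under the integral sign
   any number of times. *)
Require Import Defs.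
From HB Require Import structures.
From mathcomp Require Import all_boot all_order all_algebra.
From mathcomp Require Import complex.
From mathcomp Require Import all_classical all_reals all_analysis.
From mathcomp Require Import measurable_realfun ring lra.

Import Order.TTheory GRing.Theory Num.Theory.
Import numFieldNormedType.Exports.

Local Open Scope classical_set_scope.
Local Open Scope ring_scope.
Local Open Scope complex_scope.

Set Implicit Arguments.
Unset Strict Implicit.
Unset Printing Implicit Defensive.

(** * Complex differentiability near a point *)

(** Both [Gamma] and [zeta] are defined by cases on the real part, and the case lines run through
    the points of interest: Re z = 1 for [zeta] at 1, and Re w = -n for [Gamma w] at w = (1 - s0) /
    2 = -n when s0 = 2n + 1. Nothing local can be said until one formula is known on a full
    neighbourhood; this is the purpose of [zetaE] and [Gamma_shift].

    Differentiability of every order is carried along, since the recursion differentiates again at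
    each step and no Cauchy integral formula is used to get higher derivatives from the first one.

    As [xi] is a limit over punctured neighbourhoods, each value is found by exhibiting a function
    smooth at s0 that equals [xi_formula] off s0. The convergence is stated beside the value because
    [lim] returns a default value for a divergent filter. *)

Section LocalCalculus.
Context {K : numFieldType}.
Implicit Types (f g : K -> K) (s d : K).

Lemma nearS (P Q : K -> Prop) s : (forall z, P z -> Q z) ->
  (\forall z \near (s : K^o), P z) -> \forall z \near (s : K^o), Q z.
Proof. by move=> PQ H; near=> z; apply: PQ; near: z. Unshelve. all: by end_near. Qed.

Lemma near_and (P Q : K -> Prop) s : (\forall z \near (s : K^o), P z) ->
  (\forall z \near (s : K^o), Q z) -> \forall z \near (s : K^o), P z /\ Q z.
Proof. by move=> HP HQ; near=> z; split; near: z. Unshelve. all: by end_near. Qed.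

Definition is_cderive f s d := is_derive (s : K^o) (1 : K^o) (f : K^o -> K^o) d.

(** Naming the derivative by its canonical value lets this be passed directly to the calculus rules
    for [is_cderive]. *)
Definition derivable_at f s := is_cderive f s (derive1 (f : K -> K^o) s).

Lemma is_cderiveE f s d : is_cderive f s d -> derive1 (f : K -> K^o) s = d.
Proof. by move=> H; rewrite derive1E; exact: (@derive_val _ _ _ _ _ _ _ H). Qed.

Lemma is_cderive_derivable f s d : is_cderive f s d -> derivable_at f s.
Proof. by move=> H; rewrite /derivable_at (is_cderiveE H). Qed.

Lemma is_cderive_eq f s d d' : is_cderive f s d -> d = d' -> is_cderive f s d'.
Proof. by move=> + <-. Qed.

Lemma is_cderive_cst (c : K) s : is_cderive (fun=> c) s 0.
Proof. exact: (@is_derive_cst _ K^o K^o). Qed.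

Lemma is_cderive_id s : is_cderive id s 1.
Proof. exact: (@is_derive_id _ K^o). Qed.

Lemma is_cderiveD f g s df dg : is_cderive f s df -> is_cderive g s dg ->
  is_cderive (fun z => f z + g z) s (df + dg).
Proof. exact: (@is_deriveD K K^o K^o f g). Qed.

Lemma is_cderiveM f g s df dg : is_cderive f s df -> is_cderive g s dg ->
  is_cderive (fun z => f z * g z) s (df * g s + f s * dg).
Proof.
move=> Hf Hg.
apply: (@is_cderive_eq _ _ (f s *: dg + g s *: df)); last first.
  by rewrite addrC /GRing.scale /= [df * _]mulrC.
exact: (@is_deriveM K K^o f g s 1 df dg Hf Hg).
Qed.

Lemma is_cderiveV f s d : is_cderive f s d -> f s != 0 ->
  is_cderive (fun z => (f z)^-1) s (- d * ((f s)^-1 * (f s)^-1)).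
Proof.
move=> [Hf Ef] fs0.
suff : is_derive (s : K^o) (1 : K^o) ((fun z => (f z)^-1) : K^o -> K^o) (- f s ^- 2 *: 'D_1 (f : K^o -> K^o) s).
  move=> H; apply: (is_cderive_eq H).
  rewrite Ef /GRing.scale /= expr2 invfM; ring.
split; first exact: (@derivableV K K^o f s 1).
exact: (@deriveV K K^o f s 1).
Qed.

Lemma derivable_at_continuous f s : derivable_at f s ->
  (f : K^o -> K^o) @ (s : K^o) --> (f s : K^o).
Proof.
move=> [H _]; apply: differentiable_continuous.
by apply/derivable1_diffP.
Qed.

Lemma is_cderive_near f g s d : (\forall z \near (s : K^o), f z = g z) ->
  is_cderive f s d -> is_cderive g s d.
Proof.
by move=> fg H; apply: (@near_eq_is_derive K K^o K^o f g).
Qed.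

Lemma is_cderive_comp f g s df dg : is_cderive g s dg -> is_cderive f (g s) df ->
  is_cderive (fun z => f (g z)) s (df * dg).
Proof.
move=> Hg Hf.
have [dg1 eg] := Hg.
have [df1 ef] := Hf.
have dg2 : differentiable (g : K^o -> K^o) s by apply/derivable1_diffP.
have df2 : differentiable (f : K^o -> K^o) (g s) by apply/derivable1_diffP.
have dfg : differentiable ((f : K^o -> K^o) \o (g : K^o -> K^o)) s by exact: differentiable_comp.
split; first by apply/derivable1_diffP.
rewrite deriveE//.
rewrite diff_comp// /=.
rewrite -[X in 'd f _ X]deriveE// eg.
have -> : dg = (dg : K^o) *: (1 : K^o) by rewrite /GRing.scale /= mulr1.
by rewrite linearZ /= -deriveE// ef /GRing.scale /= mulrC mulr1.
Qed.

(** A quadratic error leaves a difference quotient within C |h| of d. The derivatives of [cexp] and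
    of the Laplace integrals are both obtained in this way. *)
Lemma is_cderive_quad f s d (C e : K) : 0 < e -> 0 <= C ->
  (forall h, `|h| < e -> `|f (s + h) - f s - d * h| <= C * `|h| ^+ 2) ->
  is_cderive f s d.
Proof.
move=> e0 C0 H.
have cv : (fun h : K => h^-1 *: (f (h *: 1 + s) - f s) : K^o) @ (0 : K^o)^' --> (d : K^o).
  apply/cvgrPdist_lt => /= eps eps0.
  (* C may be 0, so the radius is eps / (C + 1). *)
  have C1 : 0 < C + 1 by rewrite ltr_wpDl.
  near=> h.
  have h0 : h != 0 by near: h; exact: nbhs_dnbhs_neq.
  have hn : 0 < `|h| by rewrite normr_gt0.
  have he : `|h| < e.
    by near: h; apply: dnbhs0_lt.
  have hC : `|h| < eps / (C + 1).
    by near: h; apply: dnbhs0_lt; rewrite divr_gt0.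
  rewrite /GRing.scale /= mulr1 [h + s]addrC.
  have -> : d - h^-1 * (f (s + h) - f s) = - (h^-1 * (f (s + h) - f s - d * h)).
    rewrite [X in _ = - X]mulrBr opprB; congr (_ - _).
    by rewrite mulrCA mulVf// mulr1.
  rewrite normrN normrM normfV.
  have := H _ he => /(ler_wpM2l (ltW hn)).
  move=> H1; apply: (@le_lt_trans _ _ (C * `|h|)).
    have -> : C * `|h| = `|h|^-1 * (C * `|h| ^+ 2).
      by rewrite expr2; field; rewrite gt_eqF.
    by rewrite ler_wpM2l ?invr_ge0 ?normr_ge0// H.
  apply: (@le_lt_trans _ _ ((C + 1) * `|h|)); first by rewrite ler_wpM2r// lerDl.
  by rewrite mulrC -ltr_pdivlMr.
split; first by apply: (cvgP (d : K^o)); exact: cv.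
by apply: cvg_lim => //; exact: cv.
Unshelve. all: by end_near. Qed.

Fixpoint smooth (n : nat) f s : Prop :=
  if n is n'.+1 then (\forall z \near (s : K^o), derivable_at f z) /\
    smooth n' (derive1 (f : K -> K^o)) s
  else True.

Definition smooth_at f s := forall n, smooth n f s.

Lemma smooth_near n f g s : (\forall z \near (s : K^o), f z = g z) ->
  smooth n f s -> smooth n g s.
Proof.
elim: n f g => [//|n IH] f g fg /= [df sf].
(* [near_join]: equality near s is equality near every z close to s, so the derivatives agree near s
   as well. *)
have fg' := near_and df (near_join fg).
split.
  apply: nearS fg' => z [H e].
  exact: is_cderive_derivable (is_cderive_near e H).
apply: IH sf; apply: nearS fg' => z [H e].
by rewrite (is_cderiveE (is_cderive_near e H)).
Qed.

(** Leibniz' rule multiplies the derivative of one factor by the other factor itself, which the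
    induction in [smoothM] needs at the lower order. *)
Lemma smoothW n f s : smooth n.+1 f s -> smooth n f s.
Proof. by elim: n f => [//|n IH] f /= [df [ddf sf]]; split=> //; apply: IH; split. Qed.

Lemma smooth_cst n (c : K) s : smooth n (fun=> c) s.
Proof.
elim: n c => [//|n IH] c /=; split.
  by near=> z; exact: is_cderive_derivable (is_cderive_cst _ _).
apply: (@smooth_near _ (fun=> 0)); last exact: IH.
by near=> z; rewrite (is_cderiveE (is_cderive_cst _ _)).
Unshelve. all: by end_near. Qed.

Lemma smooth_id n s : smooth n id s.
Proof.
case: n => [//|n] /=; split.
  by near=> z; exact: is_cderive_derivable (is_cderive_id _).
apply: (@smooth_near _ (fun=> 1)); last exact: smooth_cst.
by near=> z; rewrite (is_cderiveE (is_cderive_id _)).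
Unshelve. all: by end_near. Qed.

Lemma smoothD n f g s : smooth n f s -> smooth n g s -> smooth n (fun z => f z + g z) s.
Proof.
elim: n f g => [//|n IH] f g /= [df sf] [dg sg]; split.
  near=> z.
  have Hf : derivable_at f z by near: z.
  have Hg : derivable_at g z by near: z.
  exact: is_cderive_derivable (is_cderiveD Hf Hg).
apply: smooth_near (IH _ _ sf sg).
near=> z.
have Hf : derivable_at f z by near: z.
have Hg : derivable_at g z by near: z.
by rewrite (is_cderiveE (is_cderiveD Hf Hg)).
Unshelve. all: by end_near. Qed.

Lemma smoothM n f g s : smooth n f s -> smooth n g s -> smooth n (fun z => f z * g z) s.
Proof.
elim: n f g => [//|n IH] f g sf1 sg1.
move: (sf1) (sg1) => /= [df sf] [dg sg]; split.
  near=> z.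
  have Hf : derivable_at f z by near: z.
  have Hg : derivable_at g z by near: z.
  exact: is_cderive_derivable (is_cderiveM Hf Hg).
apply: smooth_near (smoothD (IH _ _ sf (smoothW sg1)) (IH _ _ (smoothW sf1) sg)).
near=> z.
have Hf : derivable_at f z by near: z.
have Hg : derivable_at g z by near: z.
by rewrite (is_cderiveE (is_cderiveM Hf Hg)).
Unshelve. all: by end_near. Qed.

Lemma smoothV n f s : smooth n f s -> f s != 0 -> smooth n (fun z => (f z)^-1) s.
Proof.
move=> + fs0; elim: n f fs0 => [//|n IH] f fs0 sf1.
move: (sf1) => /= [df sf].
have nz : \forall z \near (s : K^o), f z != 0.
  have := derivable_at_continuous (nbhs_singleton df).
  by move=> /cvgr_neq0; exact.
split.
  near=> z.
  have Hf : derivable_at f z by near: z.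
  have Hz : f z != 0 by near: z.
  exact: is_cderive_derivable (is_cderiveV Hf Hz).
have s1 : smooth n (fun z => -1 * (derive1 (f : K -> K^o) z)) s.
  exact: smoothM (smooth_cst _ _ _) sf.
(* The derivative of 1/f is -f' (1/f)^2, in which 1/f is needed to one order less. *)
have s2 := IH _ fs0 (smoothW sf1).
apply: smooth_near (smoothM s1 (smoothM s2 s2)).
near=> z.
have Hf : derivable_at f z by near: z.
have Hz : f z != 0 by near: z.
by rewrite (is_cderiveE (is_cderiveV Hf Hz)) mulN1r.
Unshelve. all: by end_near. Qed.

Lemma smooth_affine n f (a b : K) s : smooth n f (a * s + b) ->
  smooth n (fun z => f (a * z + b)) s.
Proof.
elim: n f => [//|n IH] f /= [df sf].
have da z : is_cderive (fun z => a * z + b) z a.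
  apply: is_cderive_eq.
    apply: is_cderiveD (is_cderive_cst _ _).
    exact: is_cderiveM (is_cderive_cst _ _) (is_cderive_id _).
  by rewrite mul0r mulr1 addr0 add0r.
have ca : (fun z : K^o => a * z + b : K^o) @ (s : K^o) --> (a * s + b : K^o).
  exact: derivable_at_continuous (is_cderive_derivable (da s)).
have df' := ca _ df.
split.
  near=> z.
  have Hf : derivable_at f (a * z + b) by near: z; exact: df'.
  exact: is_cderive_derivable (is_cderive_comp (da z) Hf).
apply: smooth_near (smoothM (IH _ sf) (smooth_cst _ a _)).
near=> z.
have Hf : derivable_at f (a * z + b) by near: z; exact: df'.
by rewrite (is_cderiveE (is_cderive_comp (da z) Hf)).
Unshelve. all: by end_near. Qed.

Lemma smooth_at_derive f s : smooth_at f s -> smooth_at (derive1 (f : K -> K^o)) s.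
Proof. by move=> sf n; have [] := sf n.+1. Qed.

Lemma smooth_at_continuous f s : smooth_at f s -> (f : K^o -> K^o) @ (s : K^o) --> (f s : K^o).
Proof. by move=> /(_ 1%N) [/nbhs_singleton/derivable_at_continuous]. Qed.

(** Suited to explicit families of successive derivatives. The neighbourhood is common to all n, so
    it survives every differentiation. *)
Lemma smooth_tower (F : nat -> K -> K) s :
  (\forall z \near (s : K^o), forall n, is_cderive (F n) z (F n.+1 z)) ->
  smooth_at (F 0%N) s.
Proof.
move=> H n; elim: n (0%N) => [//|n IH] m /=; split.
  by apply: nearS H => z H; exact: is_cderive_derivable (H m).
apply: smooth_near (IH m.+1).
by apply: nearS H => z H; apply/esym/is_cderiveE.
Qed.

End LocalCalculus.

(** * The complex exponential *)

Section ComplexPlane.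
Context {R : realType}.
Implicit Types (s z w : R[i]) (x y : R).
Local Notation Re := (@complex.Re R).
Local Notation Im := (@complex.Im R).
Local Notation normc := (@ComplexField.Normc.normc R).

Lemma normE z : `|z| = (normc z)%:C. Proof. by []. Qed.

Lemma normc_ge0 z : 0 <= normc z.
Proof. by case: z => a b; exact: sqrtr_ge0. Qed.

Lemma normcM z w : normc (z * w) = normc z * normc w.
Proof. exact: ComplexField.Normc.normcM. Qed.

Lemma normcV z : normc z^-1 = (normc z)^-1.
Proof. exact: ComplexField.Normc.normcV. Qed.

Lemma normcD z w : normc (z + w) <= normc z + normc w.
Proof. by have := ler_normD z w; rewrite !normE -rmorphD/= lecR. Qed.

Lemma normcN z : normc (- z) = normc z.
Proof. by have := normrN z; rewrite !normE => /complexI. Qed.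

Lemma normc_real x : normc x%:C = `|x|.
Proof. by rewrite /= expr0n /= addr0 sqrtr_sqr. Qed.

Lemma normc_Re z : `|Re z| <= normc z.
Proof. by case: z => a b /=; rewrite -sqrtr_sqr ler_wsqrtr// lerDl sqr_ge0. Qed.

Lemma normc_Im z : `|Im z| <= normc z.
Proof. by case: z => a b /=; rewrite -sqrtr_sqr ler_wsqrtr// lerDr sqr_ge0. Qed.

Lemma normc_ReIm z : normc z <= `|Re z| + `|Im z|.
Proof.
rewrite [z in normc z]complexE; apply: (le_trans (normcD _ _)).
rewrite normcM !normc_real.
have -> : normc 'i%C = 1 by rewrite /= expr0n expr1n add0r sqrtr1.
by rewrite mul1r.
Qed.

Lemma cReD z w : Re (z + w) = Re z + Re w. Proof. by case: z w => [? ?] [? ?]. Qed.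
Lemma cImD z w : Im (z + w) = Im z + Im w. Proof. by case: z w => [? ?] [? ?]. Qed.
Lemma cReN z : Re (- z) = - Re z. Proof. by case: z => [? ?]. Qed.
Lemma cImN z : Im (- z) = - Im z. Proof. by case: z => [? ?]. Qed.
Lemma cReM z w : Re (z * w) = Re z * Re w - Im z * Im w.
Proof. by case: z w => [? ?] [? ?]. Qed.
Lemma cImM z w : Im (z * w) = Re z * Im w + Im z * Re w.
Proof. by case: z w => [? ?] [? ?]. Qed.
Lemma cReMr z x : Re (z * x%:C) = Re z * x.
Proof. by rewrite cReM /= mulr0 subr0. Qed.
Lemma cImMr z x : Im (z * x%:C) = Im z * x.
Proof. by rewrite cImM /= mulr0 add0r. Qed.
Lemma complex_ext z w : Re z = Re w -> Im z = Im w -> z = w.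
Proof. by case: z w => [a b] [c d] /= -> ->. Qed.

Lemma natrC n : n%:R = (n%:R)%:C :> R[i]. Proof. by rewrite rmorph_nat. Qed.
Lemma cRe_nat n : Re n%:R = n%:R. Proof. by rewrite natrC. Qed.

Lemma iE : 'i%R = 'i%C :> R[i]. Proof. by rewrite complexiE. Qed.

Lemma cexpD z w : cexp (z + w) = cexp z * cexp w.
Proof.
apply: complex_ext; rewrite /cexp.
  by rewrite !cReM !cImM /= cReD cImD expRD cosD; ring.
by rewrite !(cReM, cImM) /= cReD cImD expRD sinD; ring.
Qed.

Lemma cexp0 : cexp (0 : R[i]) = 1.
Proof. by rewrite /cexp /= expR0 cos0 sin0 mul1r. Qed.

Lemma cexp_real x : cexp x%:C = (expR x)%:C.
Proof. by rewrite /cexp /= cos0 sin0 complexr0 mulr1. Qed.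

Lemma normc_cexp z : normc (cexp z) = expR (Re z).
Proof.
rewrite /cexp normcM normc_real ger0_norm ?expR_ge0//=.
by rewrite cos2Dsin2 sqrtr1 mulr1.
Qed.

Lemma cexp_neq0 z : cexp z != 0.
Proof.
apply/eqP => /(congr1 normc); rewrite normc_cexp ComplexField.Normc.normc0.
by apply/eqP; rewrite gt_eqF// expR_gt0.
Qed.

Lemma cexpN z : cexp (- z) = (cexp z)^-1.
Proof.
apply: (mulfI (cexp_neq0 z)); rewrite -cexpD subrr cexp0 mulfV//.
exact: cexp_neq0.
Qed.

Lemma expR_sub1_le x : `|expR x - 1| <= `|x| * expR `|x|.
Proof.
have e1 := expR_ge1Dx x.
(* This is 1 - x <= e^(-x) multiplied by e^x; with [e1] it bounds e^x - 1 on both sides. *)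
have e2 : expR x * (1 - x) <= 1.
  have := expR_ge1Dx (- x); rewrite -(ler_pM2l (expR_gt0 x)) => /le_trans; apply.
  by rewrite -expRD subrr expR0.
have [x0|x0] := leP 0 x.
  rewrite ger0_norm; first by rewrite ger0_norm//; nra.
  by rewrite subr_ge0; nra.
rewrite ler0_norm; last by rewrite subr_le0 -expR0 ler_expR ltW.
rewrite (ltr0_norm x0).
apply: (@le_trans _ _ (- x * 1)); first by lra.
by rewrite ler_wpM2l ?oppr_ge0 ?(ltW x0)// -expR0 ler_expR oppr_ge0 ltW.
Qed.

Lemma expR_sub1x_le x : `|expR x - 1 - x| <= x ^+ 2 * expR `|x|.
Proof.
have e1 := expR_ge1Dx x.
have e2 : expR x * (1 - x) <= 1.
  have := expR_ge1Dx (- x); rewrite -(ler_pM2l (expR_gt0 x)) => /le_trans; apply.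
  by rewrite -expRD subrr expR0.
rewrite ger0_norm; last by lra.
apply: (@le_trans _ _ (x * (expR x - 1))); first by lra.
apply: (le_trans (ler_norm _)).
rewrite normrM (_ : x ^+ 2 = `|x| * `|x|); last by rewrite -normrM ger0_norm -expr2 ?sqr_ge0.
by rewrite -mulrA ler_wpM2l// expR_sub1_le.
Qed.

Lemma abs_sin_le x : `|sin x| <= `|x|.
Proof.
wlog x0 : x / 0 <= x.
  move=> H; have [|/ltW x0] := leP 0 x; first exact: H.
  by have := H (- x); rewrite oppr_ge0 sinN !normrN; apply.
have [->|xn0] := eqVneq x 0; first by rewrite sin0.
have x1 : 0 < x by rewrite lt_neqAle eq_sym xn0.
have [c _ E] := @MVT_segment R sin cos 0 x x0 (fun y _ => is_derive_sin y)
   (continuous_subspaceT (@continuous_sin R)).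
have {}E : sin x = cos c * x by move: E; rewrite sin0 !subr0.
by rewrite E normrM ler_piMl// ler_norml cos_geN1 cos_le1.
Qed.

Lemma abs_cos_sub1_le x : `|cos x - 1| <= x ^+ 2.
Proof.
have E : cos x - 1 = - 2 * sin (x / 2) ^+ 2.
  have -> : cos x = cos (x / 2 + x / 2) by congr cos; field.
  by have := cos2Dsin2 (x / 2); rewrite cosD; lra.
rewrite E normrM normrX normrN normr_nat.
have := abs_sin_le (x / 2) => H.
have H2 : `|sin (x / 2)| ^+ 2 <= `|x / 2| ^+ 2 by rewrite ler_pXn2r// nnegrE.
apply: (@le_trans _ _ (2 * `|x / 2| ^+ 2)); first by rewrite ler_wpM2l.
have -> : `|x / 2| ^+ 2 = x ^+ 2 / 4 by rewrite -normrX ger0_norm ?sqr_ge0// expr_div_n; congr (_ / _); ring.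
by have := sqr_ge0 x; lra.
Qed.

Lemma abs_sin_sub_le x : `|sin x - x| <= x ^+ 2.
Proof.
wlog x0 : x / 0 <= x.
  move=> H; have [|/ltW x0] := leP 0 x; first exact: H.
  by have := H (- x); rewrite oppr_ge0 sinN sqrrN -opprD normrN; apply.
have [c cx E] := @MVT_segment R (fun x => sin x - x) (fun x => cos x - 1) 0 x x0
   (fun y _ => is_deriveB (is_derive_sin y) (is_derive_id _ _))
   ltac:(apply: continuous_subspaceT => y; apply: continuousB; [exact: continuous_sin|exact: cvg_id]).
have {}E : sin x - x = (cos c - 1) * x by move: E; rewrite sin0 !subr0.
move: cx; rewrite in_itv /= => /andP[c0 cx].
rewrite E normrM (ger0_norm x0) expr2 ler_wpM2r//.
(* A bound linear in c is wanted: one factor sin (c / 2) is estimated by c / 2 and the other by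
   1. *)
have -> : cos c - 1 = - 2 * sin (c / 2) ^+ 2.
  have -> : cos c = cos (c / 2 + c / 2) by congr cos; field.
  by have := cos2Dsin2 (c / 2); rewrite cosD; lra.
rewrite normrM normrX normrN normr_nat expr2 mulrA.
have H1 := abs_sin_le (c / 2).
have H2 : `|sin (c / 2)| <= 1 by rewrite ler_norml sin_geN1 sin_le1.
have H3 : `|c / 2| = c / 2 by rewrite ger0_norm// divr_ge0.
have := normr_ge0 (sin (c / 2)).
by nra.
Qed.

(** The real and the imaginary part each split into two terms, and each of the four is at most |z|^2
    e^|z|. *)
Lemma cexp_quad z : normc (cexp z - 1 - z) <= 4 * normc z ^+ 2 * expR (normc z).
Proof.
apply: (le_trans (normc_ReIm _)).
have xN := normc_Re z; have yN := normc_Im z.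
have -> : Re (cexp z - 1 - z) = (expR (Re z) - 1 - Re z) + expR (Re z) * (cos (Im z) - 1).
  by rewrite !(cReD, cReN) /cexp cReM /= mul0r; ring.
have -> : Im (cexp z - 1 - z) = expR (Re z) * (sin (Im z) - Im z) + Im z * (expR (Re z) - 1).
  by rewrite !(cImD, cImN) /cexp cImM /= mul0r; ring.
have x1 : expR (Re z) <= expR (normc z) by rewrite ler_expR (le_trans _ xN)// ler_norm.
have x2 : expR `|Re z| <= expR (normc z) by rewrite ler_expR.
have a1 := expR_sub1x_le (Re z).
have a2 := abs_cos_sub1_le (Im z).
have a3 := abs_sin_sub_le (Im z).
have a4 := expR_sub1_le (Re z).
have E0 := expR_gt0 (normc z).
have E1 := expR_gt0 (Re z).
have N0 := normc_ge0 z.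
have X2 : Re z ^+ 2 <= normc z ^+ 2 by rewrite -real_normK ?num_real// ler_pXn2r// nnegrE.
have Y2 : Im z ^+ 2 <= normc z ^+ 2 by rewrite -real_normK ?num_real// ler_pXn2r// nnegrE.
have b1 : `|expR (Re z) - 1 - Re z| <= normc z ^+ 2 * expR (normc z).
  by apply: (le_trans a1); rewrite ler_pM// ?sqr_ge0 ?expR_ge0.
have b2 : `|expR (Re z) * (cos (Im z) - 1)| <= normc z ^+ 2 * expR (normc z).
  rewrite normrM (gtr0_norm E1) mulrC ler_pM// ?(ltW E1)//.
  exact: le_trans a2 Y2.
have b3 : `|expR (Re z) * (sin (Im z) - Im z)| <= normc z ^+ 2 * expR (normc z).
  rewrite normrM (gtr0_norm E1) mulrC ler_pM// ?(ltW E1)//.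
  exact: le_trans a3 Y2.
have b4 : `|Im z * (expR (Re z) - 1)| <= normc z ^+ 2 * expR (normc z).
  rewrite normrM expr2 -mulrA ler_pM//.
  apply: (le_trans a4); rewrite ler_pM// expR_ge0//.
apply: (le_trans (lerD (ler_normD _ _) (ler_normD _ _))).
by lra.
Qed.

Lemma is_cderive_quadc (f : R[i] -> R[i]) s d (C e : R) : 0 < e -> 0 <= C ->
  (forall h, normc h < e -> normc (f (s + h) - f s - d * h) <= C * normc h ^+ 2) ->
  is_cderive f s d.
Proof.
move=> e0 C0 H; apply: (@is_cderive_quad _ f s d C%:C e%:C).
- by rewrite ltcR.
- by rewrite lecR.
move=> h; rewrite !normE ltcR => /H; rewrite -lecR => /le_trans; apply.
by rewrite rmorphM rmorphXn.
Qed.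

Lemma is_cderive_cexp s : is_cderive cexp s (cexp s).
Proof.
apply: (@is_cderive_quadc _ _ _ (normc (cexp s) * (4 * expR 1)) 1) => //.
  by rewrite mulr_ge0 ?normc_ge0// mulr_ge0// expR_ge0.
move=> h h1.
have -> : cexp (s + h) - cexp s - cexp s * h = cexp s * (cexp h - 1 - h).
  by rewrite cexpD; ring.
rewrite normcM -mulrA ler_wpM2l ?normc_ge0//.
apply: (le_trans (cexp_quad h)).
rewrite -mulrA [X in _ <= X]mulrAC -mulrA ler_wpM2l// ler_wpM2l ?sqr_ge0//.
by rewrite ler_expR ltW.
Qed.

Lemma smooth_cexp s : smooth_at cexp s.
Proof.
apply: (@smooth_tower _ (fun _ => cexp)).
by near=> z => _; exact: is_cderive_cexp.
Unshelve. all: by end_near. Qed.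

End ComplexPlane.

(** * Integrals depending on a complex parameter *)

Section Integrals.
Context {R : realType}.
Implicit Types (s z w : R[i]) (x y : R) (D : set (measurableTypeR R)).
Local Notation Re := (@complex.Re R).
Local Notation Im := (@complex.Im R).
Local Notation normc := (@ComplexField.Normc.normc R).
Local Notation mu := (@lebesgue_measure R).

Definition rintegrable D (f : R -> R) := mu.-integrable D (EFin \o f).

Definition cintegrable D (f : R -> R[i]) :=
  rintegrable D (fun t => Re (f t)) /\ rintegrable D (fun t => Im (f t)).

Lemma le_rintegrable D (f g : R -> R) : measurable D -> measurable_fun D f ->
  (forall x, D x -> `|f x| <= g x) -> rintegrable D g -> rintegrable D f.
Proof.
move=> mD mf fg; apply: le_integrable => //; first exact/measurable_EFinP.
by move=> x Dx /=; rewrite lee_fin; apply: (le_trans (fg _ Dx)); rewrite ler_norm.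
Qed.

Lemma rintegrable_measurable D (f : R -> R) : rintegrable D f -> measurable_fun D f.
Proof. by move=> /measurable_int/measurable_EFinP. Qed.

Lemma rintegrableD D (f g : R -> R) : measurable D -> rintegrable D f -> rintegrable D g ->
  rintegrable D (fun x => f x + g x).
Proof. move=> mD fi gi; rewrite /rintegrable.
have -> : EFin \o (fun x => f x + g x) = ((EFin \o f) \+ (EFin \o g))%E by exact/funext.
exact: integrableD. Qed.

Lemma rintegrableB D (f g : R -> R) : measurable D -> rintegrable D f -> rintegrable D g ->
  rintegrable D (fun x => f x - g x).
Proof. move=> mD fi gi; rewrite /rintegrable.
have -> : EFin \o (fun x => f x - g x) = ((EFin \o f) \- (EFin \o g))%E by exact/funext.
exact: integrableB. Qed.

Lemma rintegrableZ D (k : R) (f : R -> R) : measurable D -> rintegrable D f ->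
  rintegrable D (fun x => k * f x).
Proof. move=> mD fi; rewrite /rintegrable.
have -> : EFin \o (fun x => k * f x) = (fun x => k%:E * (EFin \o f) x)%E by exact/funext.
exact: integrableZl. Qed.

Lemma cintegrableD D (f g : R -> R[i]) : measurable D -> cintegrable D f ->
  cintegrable D g -> cintegrable D (fun t => f t + g t).
Proof.
move=> mD [f1 f2] [g1 g2]; split.
  under [X in rintegrable _ X]eq_fun do rewrite cReD; exact: rintegrableD.
under [X in rintegrable _ X]eq_fun do rewrite cImD; exact: rintegrableD.
Qed.

Lemma cintegrableZ D c (f : R -> R[i]) : measurable D -> cintegrable D f ->
  cintegrable D (fun t => c * f t).
Proof.
move=> mD [f1 f2]; split.
  under [X in rintegrable _ X]eq_fun do rewrite cReM.
  by apply: rintegrableB => //; exact: rintegrableZ.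
under [X in rintegrable _ X]eq_fun do rewrite cImM.
by apply: rintegrableD => //; exact: rintegrableZ.
Qed.

Lemma cintegralD D (f g : R -> R[i]) : measurable D -> cintegrable D f -> cintegrable D g ->
  cintegral D (fun t => f t + g t) = cintegral D f + cintegral D g.
Proof.
move=> mD [f1 f2] [g1 g2]; apply: complex_ext; rewrite /cintegral ?cReD ?cImD /=.
  by rewrite -RintegralD//; apply: eq_Rintegral => x _; rewrite cReD.
by rewrite -RintegralD//; apply: eq_Rintegral => x _; rewrite cImD.
Qed.

Lemma cintegralZ D c (f : R -> R[i]) : measurable D -> cintegrable D f ->
  cintegral D (fun t => c * f t) = c * cintegral D f.
Proof.
move=> mD [f1 f2]; apply: complex_ext; rewrite /cintegral ?cReM ?cImM /=.
  rewrite -!RintegralZl// -RintegralB//; [|exact: rintegrableZ..].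
  by apply: eq_Rintegral => x _; rewrite cReM.
rewrite -!RintegralZl// -RintegralD//; [|exact: rintegrableZ..].
by apply: eq_Rintegral => x _; rewrite cImM.
Qed.

Lemma eq_cintegral D (f g : R -> R[i]) : (forall x, D x -> f x = g x) ->
  cintegral D f = cintegral D g.
Proof.
move=> fg; rewrite /cintegral; congr (_ +i* _); apply: eq_Rintegral => x;
  by rewrite inE => /fg ->.
Qed.

Lemma eq_rintegrable D (f g : R -> R) : measurable D -> (forall x, D x -> f x = g x) ->
  rintegrable D f -> rintegrable D g.
Proof.
by move=> mD fg; apply: eq_integrable => // x; rewrite inE => /fg /= ->.
Qed.

Lemma eq_cintegrable D (f g : R -> R[i]) : measurable D -> (forall x, D x -> f x = g x) ->
  cintegrable D f -> cintegrable D g.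
Proof.
by move=> mD fg [f1 f2]; split; [move: f1|move: f2]; apply: eq_rintegrable => // x /fg ->.
Qed.

Lemma cintegrableS D E (f : R -> R[i]) : measurable D -> measurable E -> E `<=` D ->
  cintegrable D f -> cintegrable E f.
Proof. by move=> mD mE ED [f1 f2]; split; [move: f1|move: f2]; exact: integrableS. Qed.

(** The factor 2 comes from bounding the real and imaginary parts separately. *)
Lemma cintegral_le D (f : R -> R[i]) (G : R -> R) : measurable D -> cintegrable D f ->
  rintegrable D G -> (forall x, D x -> normc (f x) <= G x) ->
  normc (cintegral D f) <= 2 * Rintegral mu D G.
Proof.
move=> mD [f1 f2] iG fG.
have H (h : R -> R) : rintegrable D h -> (forall x, D x -> `|h x| <= G x) ->
    `|Rintegral mu D h| <= Rintegral mu D G.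
  move=> ih hG; apply: (le_trans (le_normr_Rintegral mD ih)).
  by apply: le_Rintegral => //; exact: integrable_norm.
apply: (le_trans (normc_ReIm _)); rewrite /= mulr2n mulrDl mul1r; apply: lerD.
  by apply: H => // x Dx; exact: le_trans (normc_Re _) (fG _ Dx).
by apply: H => // x Dx; exact: le_trans (normc_Im _) (fG _ Dx).
Qed.

Lemma le_cintegrable D (f : R -> R[i]) (G : R -> R) : measurable D ->
  measurable_fun D (fun t => Re (f t)) -> measurable_fun D (fun t => Im (f t)) ->
  rintegrable D G -> (forall x, D x -> normc (f x) <= G x) -> cintegrable D f.
Proof.
move=> mD m1 m2 iG fG; split.
  by apply: le_rintegrable iG => // x Dx; exact: le_trans (normc_Re _) (fG _ Dx).
by apply: le_rintegrable iG => // x Dx; exact: le_trans (normc_Im _) (fG _ Dx).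
Qed.

(** Dominated convergence for f cut off to E n, with |f| as the dominating function. *)
Lemma Rintegral_exhaust D (E : (set (measurableTypeR R))^nat) (f : R -> R) : measurable D ->
  (forall n, measurable (E n)) -> (forall n, E n `<=` D) ->
  (forall x, D x -> \forall n \near \oo, E n x) -> rintegrable D f ->
  Rintegral mu (E n) f @[n --> \oo] --> Rintegral mu D f.
Proof.
move=> mD mE ED DE fi.
have mf := rintegrable_measurable fi.
apply: fine_cvg; rewrite fineK; last exact: integrable_fin_num.
have H : (\int[mu]_(x in D) (EFin \o (f \_ (E n))) x @[n --> \oo] --> \int[mu]_(x in D) (f x)%:E)%E.
  apply: (@dominated_cvg _ _ _ mu D mD (fun n => EFin \o (f \_ (E n))) _ (fun x => `|f x|%:E)).
  - move=> n; apply/measurable_EFinP; apply/measurable_restrict => //.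
    by apply: measurable_funS mf => //; exact: subIsetr.
  - move=> x Dx; apply: cvg_near_cst; apply: filterS (DE x Dx) => n En /=.
    by rewrite patchE mem_set.
  - by [].
  - exact: integrable_norm.
  - move=> n x Dx /=; rewrite lee_fin patchE; case: ifP => // _.
    by rewrite normr0.
apply: cvg_trans H; apply: near_eq_cvg; near=> n.
rewrite -[in RHS](setIidr (ED n)) [RHS]integral_mkcondr.
by apply: eq_integral => x _ /=; rewrite !patchE; case: ifP.
Unshelve. all: by end_near. Qed.

(** * Differentiation under the integral sign *)

Section LaplaceTransform.
Variables (D : set (measurableTypeR R)) (w u : R -> R) (a b : R).
Hypothesis mD : measurable D.
Hypotheses (mw : measurable_fun D w) (mu' : measurable_fun D u).
Hypothesis wi : forall x, a < x < b -> rintegrable D (fun t => w t * expR (x * u t)).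

(** The k-th derivative in s of w(t) e^(s u(t)): each differentiation brings down a factor u(t). *)
Definition laplace_integrand (k : nat) s t : R[i] := (w t * u t ^+ k)%:C * cexp (s * (u t)%:C).

Definition laplace k s : R[i] := cintegral D (laplace_integrand k s).

Let pow_le_expR k (e : R) : 0 < e -> exists2 C : R, 0 <= C & forall x, 0 <= x -> x ^+ k <= C * expR (e * x).
Proof.
(* With y = e x / (k + 1), y^k <= (e^y)^k <= e^(e x). Dividing by k + 1 instead of k covers k =
   0. *)
move=> e0; exists ((k.+1%:R / e) ^+ k); first by rewrite exprn_ge0// divr_ge0// ltW.
move=> x x0.
have y0 : 0 <= e * x / k.+1%:R by rewrite divr_ge0// mulr_ge0// ltW.
have -> : x ^+ k = (k.+1%:R / e) ^+ k * (e * x / k.+1%:R) ^+ k.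
  by rewrite -exprMn; congr (_ ^+ _); field; rewrite nat1r pnatr_eq0/= gt_eqF.
rewrite ler_wpM2l ?exprn_ge0 ?divr_ge0 ?(ltW e0)//.
have -> : expR (e * x) = expR (k.+1%:R * (e * x / k.+1%:R)).
  by congr expR; field; rewrite nat1r pnatr_eq0.
move: (e * x / _) y0 => y y0.
rewrite expRM_natl; apply: (@le_trans _ _ (expR y ^+ k)).
  by rewrite lerXn2r ?nnegrE ?expR_ge0//; have := expR_ge1Dx y; lra.
by rewrite exprS ler_peMl ?exprn_ge0 ?expR_ge0// -expR0 ler_expR.
Qed.

Lemma Re_laplace_integrand k s t : Re (laplace_integrand k s t) =
  w t * u t ^+ k * (expR (Re s * u t) * cos (Im s * u t)).
Proof.
by rewrite /laplace_integrand /cexp !(cReM, cImM) /= !(mulr0, mul0r, subr0, add0r, addr0).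
Qed.

Lemma Im_laplace_integrand k s t : Im (laplace_integrand k s t) =
  w t * u t ^+ k * (expR (Re s * u t) * sin (Im s * u t)).
Proof.
by rewrite /laplace_integrand /cexp !(cReM, cImM) /= !(mulr0, mul0r, subr0, add0r, addr0).
Qed.

Lemma normc_laplace_integrand k s t : normc (laplace_integrand k s t) =
  `|w t| * `|u t| ^+ k * expR (Re s * u t).
Proof. by rewrite normcM normc_real normc_cexp cReMr normrM normrX. Qed.

Let measurable_laplace k s : measurable_fun D (fun t => Re (laplace_integrand k s t)) /\
  measurable_fun D (fun t => Im (laplace_integrand k s t)).
Proof.
have m1 : measurable_fun D (fun t => w t * u t ^+ k).
  by apply: measurable_funM => //; exact: measurable_funX.
have mZ (c : R) : measurable_fun D (fun t => c * u t) by apply: measurable_funM.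
have m2 : measurable_fun D (fun t => expR (Re s * u t)).
  exact: measurableT_comp (@measurable_expR R) (mZ _).
have mc : measurable_fun setT (@cos R) by apply: continuous_measurable_fun; exact: continuous_cos.
have ms : measurable_fun setT (@sin R) by apply: continuous_measurable_fun; exact: continuous_sin.
split.
  under [X in measurable_fun _ X]eq_fun do rewrite Re_laplace_integrand.
  apply: measurable_funM => //; apply: measurable_funM => //.
  exact: measurableT_comp mc (mZ _).
under [X in measurable_fun _ X]eq_fun do rewrite Im_laplace_integrand.
apply: measurable_funM => //; apply: measurable_funM => //.
exact: measurableT_comp ms (mZ _).
Qed.

(* Moving the abscissa by at most [r] in both directions dominates every power of [u]. *)
Let laplace_bound s : a < Re s < b -> exists G : R -> R, exists2 r : R, 0 < r &
  (rintegrable D G /\ (forall t, 0 <= G t)) /\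
  forall k, exists2 C : R, 0 <= C & forall t,
   `|w t| * `|u t| ^+ k * expR (Re s * u t) * expR (r * `|u t|) <= C * G t.
Proof.
move=> /andP[ax xb]; set x := Re s in ax xb *.
(* Of the margin 2r, one r absorbs |u|^k through [pow_le_expR] and the other absorbs e^(r |u|). *)
have [r r0 [r1 r2]] : exists2 r : R, 0 < r & a < x - r *+ 2 /\ x + r *+ 2 < b.
  exists (Num.min (x - a) (b - x) / 4).
    by rewrite divr_gt0// lt_min !subr_gt0 ax xb.
  have h1 : Num.min (x - a) (b - x) <= x - a by rewrite ge_min lexx.
  have h2 : Num.min (x - a) (b - x) <= b - x by rewrite ge_min lexx orbT.
  by split; lra.
exists (fun t => `|w t * expR ((x - r *+ 2) * u t)| + `|w t * expR ((x + r *+ 2) * u t)|), r => //; split.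
  split; last by move=> t; rewrite addr_ge0.
  apply: rintegrableD => //; apply: integrable_norm; apply: wi; apply/andP; split; lra.
move=> k; have [C C0 HC] := pow_le_expR k r0.
exists C => // t.
rewrite !normrM !(ger0_norm (expR_ge0 _)) -mulrDr.
have -> : `|w t| * `|u t| ^+ k * expR (x * u t) * expR (r * `|u t|) =
  `|w t| * (`|u t| ^+ k * (expR (x * u t) * expR (r * `|u t|))) by ring.
rewrite [X in _ <= X]mulrCA ler_wpM2l//.
apply: (@le_trans _ _ (C * expR (r * `|u t|) * (expR (x * u t) * expR (r * `|u t|)))).
  by rewrite ler_wpM2r ?HC// mulr_ge0 ?expR_ge0.
rewrite -mulrA ler_wpM2l// -!expRD.
(* The sign of u t decides which of the two summands of G does the domination. *)
have [u0|u0] := leP 0 (u t).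
  by rewrite (ger0_norm u0); apply: ler_wpDl; rewrite ?expR_ge0// ler_expR; rewrite le_eqVlt; apply/orP; left; apply/eqP; ring.
by rewrite (ltr0_norm u0); apply: ler_wpDr; rewrite ?expR_ge0// ler_expR; rewrite le_eqVlt; apply/orP; left; apply/eqP; ring.
Qed.

Lemma laplace_integrable k s : a < Re s < b -> cintegrable D (laplace_integrand k s).
Proof.
move=> /laplace_bound[G [r r0 [[iG G0] /(_ k)[C C0 H]]]].
have [m1 m2] := measurable_laplace k s.
apply: (@le_cintegrable _ _ (fun t => C * G t)) => //; first exact: rintegrableZ.
move=> t Dt; rewrite normc_laplace_integrand; apply: le_trans (H t).
rewrite ler_peMr// ?mulr_ge0 ?exprn_ge0 ?expR_ge0//.
by rewrite -expR0 ler_expR mulr_ge0// ltW.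
Qed.

Lemma is_cderive_laplace k s : a < Re s < b -> is_cderive (laplace k) s (laplace k.+1 s).
Proof.
move=> sab; have [G [r r0 [[iG G0] H]]] := laplace_bound sab.
(* Order k + 2, since the remainder e^(h u) - 1 - h u contributes |u|^2. Below, e <= r ensures that
   its factor e^(|h| |u|) is covered by e^(r |u|). *)
have [C C0 HC] := H k.+2.
have [e e0 [er he]] : exists2 e : R, 0 < e & e <= r /\ forall h, normc h < e -> a < Re (s + h) < b.
  move: sab => /andP[ax xb].
  exists (Num.min r (Num.min (Re s - a) (b - Re s))).
    by rewrite !lt_min r0 !subr_gt0 ax.
  split; first by rewrite ge_min lexx.
  move=> h; rewrite !lt_min => /and3P[_ h1 h2]; have := normc_Re h; rewrite cReD ler_norml.
  by lra.
apply: (@is_cderive_quadc _ _ _ _ (2 * (4 * C * Rintegral mu D G)) e) => //.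
  by rewrite !mulr_ge0//; apply: Rintegral_ge0.
move=> h hlt.
have i1 := laplace_integrable k (he _ hlt).
have i2 := laplace_integrable k sab.
have i3 := laplace_integrable k.+1 sab.
have -> : laplace k (s + h) - laplace k s - laplace k.+1 s * h =
   cintegral D (fun t => laplace_integrand k (s + h) t +
      (-1) * laplace_integrand k s t + (- h) * laplace_integrand k.+1 s t).
  rewrite cintegralD//; [|exact: cintegrableD (cintegrableZ _ _ _)|exact: cintegrableZ].
  rewrite cintegralD//; [|exact: cintegrableZ].
  by rewrite !cintegralZ// mulN1r mulNr [h * _]mulrC.
have -> : 2 * (4 * C * Rintegral mu D G) * normc h ^+ 2 =
   2 * Rintegral mu D (fun t => (4 * C * normc h ^+ 2) * G t).
  by rewrite RintegralZl//; ring.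
apply: cintegral_le => //.
- apply: cintegrableD => //; [apply: cintegrableD => //|]; exact: cintegrableZ.
- exact: rintegrableZ.
move=> t Dt.
have -> : laplace_integrand k (s + h) t + -1 * laplace_integrand k s t +
    - h * laplace_integrand k.+1 s t =
   laplace_integrand k s t * (cexp (h * (u t)%:C) - 1 - h * (u t)%:C).
  rewrite /laplace_integrand mulrDl cexpD exprS !rmorphM /=; ring.
rewrite normcM normc_laplace_integrand.
have := cexp_quad (h * (u t)%:C); rewrite normcM normc_real => H1.
apply: (le_trans (ler_wpM2l _ H1)).
  by rewrite !mulr_ge0// ?exprn_ge0 ?expR_ge0.
have -> : `|w t| * `|u t| ^+ k * expR (Re s * u t) *
    (4 * (normc h * `|u t|) ^+ 2 * expR (normc h * `|u t|)) =
  4 * normc h ^+ 2 * (`|w t| * `|u t| ^+ k.+2 * expR (Re s * u t) * expR (normc h * `|u t|)).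
  by rewrite !exprS expr0; ring.
have -> : 4 * C * normc h ^+ 2 * G t = 4 * normc h ^+ 2 * (C * G t) by ring.
apply: ler_wpM2l; first by rewrite mulr_ge0// sqr_ge0.
apply: le_trans (HC t).
apply: ler_wpM2l; first by rewrite mulr_ge0 ?expR_ge0// mulr_ge0// exprn_ge0.
by rewrite ler_expR ler_wpM2r// ltW// (lt_le_trans hlt).
Qed.

Lemma smooth_laplace s : a < Re s < b -> smooth_at (laplace 0) s.
Proof.
move=> sab; apply: smooth_tower.
have : \forall z \near (s : R[i]^o), a < Re z < b.
  move: sab => /andP[ax xb].
  have e0 : 0 < Num.min (Re s - a) (b - Re s) by rewrite lt_min !subr_gt0 ax.
  have e0' : 0 < (Num.min (Re s - a) (b - Re s))%:C by rewrite ltcR.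
  near=> z.
  have : `|s - z| < (Num.min (Re s - a) (b - Re s))%:C.
    by near: z; exact: (@nbhsx_ballx _ R[i]^o).
  rewrite normE ltcR lt_min => /andP[h1 h2].
  have := normc_Re (s - z); rewrite cReD cReN ler_norml.
  by lra.
by apply: nearS => z zab n; exact: is_cderive_laplace.
Unshelve. all: by end_near. Qed.

End LaplaceTransform.
End Integrals.

(** * The fundamental theorem of calculus for complex-valued functions *)

Section RealVariable.
Context {R : realType}.
Implicit Types (s z w : R[i]) (x y t : R) (D : set (measurableTypeR R)).
Local Notation Re := (@complex.Re R).
Local Notation Im := (@complex.Im R).
Local Notation normc := (@ComplexField.Normc.normc R).
Local Notation mu := (@lebesgue_measure R).

Definition is_rderive (F : R -> R[i]) t d :=
  is_derive t 1 (fun x => Re (F x)) (Re d) /\ is_derive t 1 (fun x => Im (F x)) (Im d).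

Lemma is_rderive_eq F t d d' : is_rderive F t d -> d = d' -> is_rderive F t d'.
Proof. by move=> + <-. Qed.

Lemma is_rderive_real (f : R -> R) t d : is_derive t 1 f d -> is_rderive (fun x => (f x)%:C) t d%:C.
Proof. by move=> H; split => //=; exact: is_derive_cst. Qed.

Lemma is_rderive_cst c t : is_rderive (fun=> c) t 0.
Proof. by split; exact: is_derive_cst. Qed.

Lemma is_rderiveD F G t d e : is_rderive F t d -> is_rderive G t e ->
  is_rderive (fun x => F x + G x) t (d + e).
Proof.
move=> [F1 F2] [G1 G2]; split.
  rewrite cReD; under eq_fun do rewrite cReD.
  exact: is_deriveD F1 G1.
rewrite cImD; under eq_fun do rewrite cImD.
exact: is_deriveD F2 G2.
Qed.

Lemma is_rderiveM F G t d e : is_rderive F t d -> is_rderive G t e ->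
  is_rderive (fun x => F x * G x) t (d * G t + F t * e).
Proof.
move=> [F1 F2] [G1 G2]; split.
  under eq_fun do rewrite cReM.
  apply: is_derive_eq (is_deriveB (is_deriveM F1 G1) (is_deriveM F2 G2)) _.
  by rewrite cReD !cReM /GRing.scale /=; ring.
under eq_fun do rewrite cImM.
apply: is_derive_eq (is_deriveD (is_deriveM F1 G2) (is_deriveM F2 G1)) _.
by rewrite cImD !cImM /GRing.scale /=; ring.
Qed.

Lemma is_rderiveZ c F t d : is_rderive F t d -> is_rderive (fun x => c * F x) t (c * d).
Proof.
by move=> H; apply: is_rderive_eq (is_rderiveM (is_rderive_cst c t) H) _; rewrite mul0r add0r.
Qed.

Lemma cpow_subr1 t s : 0 < t -> cpow t (s - 1) = cpow t s * (t^-1)%:C.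
Proof.
move=> t0; rewrite /cpow mulrDl cexpD mulN1r -rmorphN /= cexp_real expRN lnK//.
Qed.

Lemma is_rderive_cexpM s t (f : R -> R) d : is_derive t 1 f d ->
  is_rderive (fun x => cexp (s * (f x)%:C)) t (s * d%:C * cexp (s * (f t)%:C)).
Proof.
move=> fd.
have E x : cexp (s * (f x)%:C) =
    (expR (Re s * f x))%:C * ((cos (Im s * f x))%:C + 'i%C * (sin (Im s * f x))%:C).
  by apply: complex_ext; rewrite /cexp cReMr cImMr !(cReM, cImM, cReD, cImD) /=; ring.
have dZ (c : R) : is_derive t 1 (fun x => c * f x) (c * d).
  by apply: is_derive_eq (is_deriveZ c fd) _.
have d1 : is_derive t 1 (fun x => expR (Re s * f x)) (expR (Re s * f t) * (Re s * d)).
  exact: (is_derive1_comp (is_derive_expR _) (dZ _)).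
have d2 : is_derive t 1 (fun x => cos (Im s * f x)) (- sin (Im s * f t) * (Im s * d)).
  exact: (is_derive1_comp (is_derive_cos _) (dZ _)).
have d3 : is_derive t 1 (fun x => sin (Im s * f x)) (cos (Im s * f t) * (Im s * d)).
  exact: (is_derive1_comp (is_derive_sin _) (dZ _)).
rewrite E; under eq_fun do rewrite E.
apply: is_rderive_eq (is_rderiveM (is_rderive_real d1) (is_rderiveD (is_rderive_real d2)
  (is_rderiveZ 'i%C (is_rderive_real d3)))) _.
by apply: complex_ext; rewrite !(cReM, cImM, cReD, cImD) /=; ring.
Qed.

Lemma is_rderive_cpow s t : 0 < t -> is_rderive (fun x => cpow x s) t (s * cpow t (s - 1)).
Proof.
move=> t0; apply: is_rderive_eq (is_rderive_cexpM s (is_derive1_ln t0)) _.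
by rewrite cpow_subr1// /cpow; ring.
Qed.

Lemma normc_cpow s t : normc (cpow t s) = expR (Re s * ln t).
Proof. by rewrite /cpow normc_cexp cReMr. Qed.

Lemma Rintegral_FTC (F f : R -> R) (a b : R) : a < b ->
  (forall t, a <= t <= b -> is_derive t 1 F (f t)) ->
  (forall t, a <= t <= b -> {for t, continuous f}) ->
  Rintegral mu `[a, b] f = F b - F a.
Proof.
move=> ab dF cf.
have cF t : a <= t <= b -> {for t, continuous F}.
  by move=> /dF[H _]; apply: differentiable_continuous; exact/derivable1_diffP.
have aab : a <= a <= b by rewrite lexx ltW.
have bab : a <= b <= b by rewrite lexx ltW.
rewrite /Rintegral (@continuous_FTC2 _ f F)//.
- apply: continuous_in_subspaceT => x; rewrite inE /= in_itv /= => xab.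
  exact: cf.
- split.
  + move=> x; rewrite in_itv /= => /andP[ax xb].
    by have [|] := dF x; rewrite ?(ltW ax) ?(ltW xb).
  + by apply: cvg_at_right_filter; exact: cF.
  + by apply: cvg_at_left_filter; exact: cF.
- move=> x; rewrite in_itv /= => /andP[ax xb]; rewrite derive1E.
  by apply: derive_val; apply: dF; rewrite (ltW ax) (ltW xb).
Qed.

(** Differentiability of f serves as a convenient source of the continuity of its two components. *)
Lemma cintegral_FTC (F f : R -> R[i]) (a b : R) : a < b ->
  (forall t, a <= t <= b -> is_rderive F t (f t)) ->
  (forall t, a <= t <= b -> exists d, is_rderive f t d) ->
  cintegral `[a, b] f = F b - F a.
Proof.
move=> ab dF df.
have cont (g : R -> R) t d : is_derive t 1 g d -> {for t, continuous g}.
  by move=> [H _]; apply: differentiable_continuous; exact/derivable1_diffP.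
apply: complex_ext; rewrite ?(cReD, cReN, cImD, cImN) /=.
  apply: (@Rintegral_FTC (fun t => Re (F t))) => // t tab; first by have [] := dF _ tab.
  by have [d [h _]] := df _ tab; exact: cont h.
apply: (@Rintegral_FTC (fun t => Im (F t))) => // t tab; first by have [] := dF _ tab.
by have [d [_ h]] := df _ tab; exact: cont h.
Qed.

(** For evaluating improper integrals: the integrals over E n tend to that over D by dominated
    convergence and to L by hypothesis, and limits are unique. *)
Lemma cintegral_exhaust D (E : (set (measurableTypeR R))^nat) (f : R -> R[i]) L :
  measurable D -> (forall n, measurable (E n)) -> (forall n, E n `<=` D) ->
  (forall x, D x -> \forall n \near \oo, E n x) -> cintegrable D f ->
  normc (cintegral (E n) f - L) @[n --> \oo] --> (0 : R) ->
  cintegral D f = L.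
Proof.
move=> mD mE ED DE [f1 f2] H.
have lim (g : nat -> R) l l' : g n @[n --> \oo] --> l ->
    (forall n, `|g n - l'| <= normc (cintegral (E n) f - L)) -> l = l'.
  move=> gl gl'; apply: (cvg_unique _ gl) => //.
  apply/cvgrPdist_le => e e0; move/cvgrPdist_le : H => /(_ _ e0).
  apply: filterS => n; rewrite sub0r normrN ger0_norm ?normc_ge0// => h.
  by rewrite distrC (le_trans (gl' n)).
apply: complex_ext.
  apply: (lim _ _ _ (Rintegral_exhaust mD mE ED DE f1)) => n.
  by apply: le_trans (normc_Re _); rewrite cReD cReN.
apply: (lim _ _ _ (Rintegral_exhaust mD mE ED DE f2)) => n.
by apply: le_trans (normc_Im _); rewrite cImD cImN.
Qed.

(** The sequence is (n + 2)^(-c), written in the form in which powers appear here. *)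
Lemma cvg_expRN_ln (c : R) : 0 < c -> expR (- (c * ln n.+2%:R)) @[n --> \oo] --> (0 : R).
Proof.
move=> c0.
apply/cvgrPdist_le => e e0.
near=> n.
rewrite sub0r normrN ger0_norm ?expR_ge0//.
rewrite -[e]lnK ?posrE// ler_expR lerNl -ler_pdivrMl//.
rewrite -[X in X <= _]expRK ler_ln ?posrE ?expR_gt0 ?ltr0n//.
apply: (@le_trans _ _ n%:R); last by rewrite ler_nat -addn2 leq_addr.
by near: n; exact: nbhs_infty_ger.
Unshelve. all: by end_near. Qed.

(** From ln y <= y at y = t / c. Exponentiated, it says that t^c is at most a constant times e^t. *)
Lemma lnM_le (c t : R) : 0 < c -> 0 < t -> c * ln t <= t + `|c * ln c|.
Proof.
move=> c0 t0.
have : ln (t / c) <= t / c by apply/ltW/ln_sublinear; rewrite divr_gt0.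
rewrite ln_div ?posrE// => h.
have : c * (ln t - ln c) <= c * (t / c) by rewrite ler_wpM2l// ltW.
rewrite mulrCA divff ?gt_eqF// mulr1 => h2.
have := ler_norm (c * ln c); lra.
Qed.

(* The derivative of [- 1 / (1 + t ^ c)], hence integrable on the half-line; up
   to a constant it dominates both the Gamma and the zeta integrands. *)
Definition dominating (c t : R) : R := c * (expR (c * ln t) / t) / (1 + expR (c * ln t)) ^+ 2.

(** Starting from 2 keeps the endpoints distinct for every n, as the fundamental theorem
    requires. *)
Definition exhaust_itv (n : nat) : set (measurableTypeR R) := `[n.+2%:R^-1, n.+2%:R].

Lemma exhaust_itvP (x : R) : 0 < x -> \forall n \near \oo, exhaust_itv n x.
Proof.
move=> x0; near=> n; rewrite /exhaust_itv /= in_itv /=; apply/andP; split.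
  rewrite -[x]invrK lef_pV2 ?posrE ?ltr0n ?invr_gt0//.
  apply: (@le_trans _ _ n%:R); last by rewrite ler_nat -addn2 leq_addr.
  by near: n; exact: nbhs_infty_ger.
apply: (@le_trans _ _ n%:R); last by rewrite ler_nat -addn2 leq_addr.
by near: n; exact: nbhs_infty_ger.
Unshelve. all: by end_near. Qed.

Lemma exhaust_itv_sub n : exhaust_itv n `<=` `]0, +oo[.
Proof.
move=> x; rewrite /exhaust_itv /= !in_itv /= => /andP[h _]; rewrite andbT.
by apply: lt_le_trans h; rewrite invr_gt0 ltr0n.
Qed.

Lemma exhaust_itv_lt n : n.+2%:R^-1 < n.+2%:R :> R.
Proof.
apply: (@lt_trans _ _ 1); last by rewrite ltr1n.
by rewrite invf_lt1 ?ltr1n// ltr0n.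
Qed.

(** The primitive takes values between -1 and 0, so the integrals over the exhausting intervals are
    at most 1; monotone convergence carries the bound to the half-line. *)
Lemma rintegrable_dominating c : 0 < c -> rintegrable `]0, +oo[ (dominating c).
Proof.
move=> c0.
have dl (t : R) : 0 < t -> is_derive t 1 (fun x => expR (c * ln x)) (expR (c * ln t) * (c * t^-1)).
  move=> t0; apply: is_derive1_comp (is_derive_expR _) _.
  exact: is_derive_eq (is_deriveZ c (is_derive1_ln t0)) _.
have pos t : 0 < 1 + expR (c * ln t) by have := expR_gt0 (c * ln t); lra.
have dD (t : R) : 0 < t -> is_derive t 1 (fun x => - (1 + expR (c * ln x))^-1) (dominating c t).
  move=> t0.
  have d1 := is_deriveD (is_derive_cst (1 : R) t 1) (dl t t0).
  have d2 : derivable (fun x => 1 + expR (c * ln x)) t 1 by case: d1.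
  have nz : 1 + expR (c * ln t) != 0 by rewrite gt_eqF.
  split; first by apply: derivableN; exact: derivableV.
  rewrite deriveN; last exact: derivableV.
  rewrite deriveV// (@derive_val _ _ _ _ _ _ _ d1) /dominating /GRing.scale /=; field.
  by rewrite nz gt_eqF.
have cd (t : R) : 0 < t -> {for t, continuous (dominating c)}.
  move=> t0.
  have cl : {for t, continuous (fun x => expR (c * ln x))}.
    have [H _] := dl _ t0; apply: differentiable_continuous; exact/derivable1_diffP.
  rewrite /dominating; apply: cvgM.
    apply: cvgM; first exact: cvg_cst.
    by apply: cvgM => //; apply: cvgV => //; rewrite gt_eqF.
  apply: cvgV; first by rewrite sqrf_eq0 gt_eqF.
  by apply: cvgM; apply: cvgD => //; exact: cvg_cst.
have dom0 t : 0 < t -> 0 <= dominating c t.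
  move=> t0; rewrite /dominating divr_ge0 ?sqr_ge0// mulr_ge0 ?(ltW c0)//.
  by rewrite divr_ge0 ?expR_ge0// ltW.
have md : measurable_fun (`]0, +oo[ : set (measurableTypeR R)) (dominating c).
  apply: open_continuous_measurable_fun; first exact: interval_open.
  by move=> t; rewrite inE /= in_itv /= andbT => t0; exact: cd.
have mE n : measurable (exhaust_itv n) by exact: measurable_itv.
have uE : \bigcup_n exhaust_itv n = `]0, +oo[%classic :> set (measurableTypeR R).
  apply/seteqP; split=> [x [n _]|x]; first exact: exhaust_itv_sub.
  rewrite /= in_itv /= andbT => x0; have [N _ H] := exhaust_itvP x0.
  by exists N => //; apply: H => /=.
apply/integrableP; split; first exact/measurable_EFinP.
rewrite (_ : (\int[mu]_(x in `]0%R, +oo[) `|(EFin \o dominating c) x|)%E =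
  (\int[mu]_(x in `]0%R, +oo[) (dominating c x)%:E)%E); last first.
  apply: eq_integral => x; rewrite inE /= in_itv /= andbT => x0.
  by rewrite ger0_norm// dom0.
have cv : (\int[mu]_(x in exhaust_itv n) (dominating c x)%:E @[n --> \oo] -->
    \int[mu]_(x in `]0%R, +oo[) (dominating c x)%:E)%E.
  rewrite -uE; apply: ge0_nondecreasing_set_cvg_integral => //.
  - move=> m n mn; apply/subsetPset => x; rewrite /exhaust_itv /= !in_itv /= => /andP[h1 h2].
    apply/andP; split; last by apply: (le_trans h2); rewrite ler_nat.
    by apply: le_trans h1; rewrite lef_pV2 ?posrE ?ltr0n// ler_nat.
  - by move=> n; apply/measurable_EFinP; apply: measurable_funS md => //; exact: exhaust_itv_sub.
  - move=> n x /exhaust_itv_sub; rewrite /= in_itv /= andbT => x0.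
    by rewrite lee_fin dom0.
apply: (@le_lt_trans _ _ 1%:E); last exact: ltry.
rewrite -(cvg_lim _ cv)//; apply: lime_le; first by apply: cvgP cv.
apply: nearW => n.
have ab := exhaust_itv_lt n.
have tp t : n.+2%:R^-1 <= t <= n.+2%:R -> 0 < t.
  by move=> /andP[h _]; apply: lt_le_trans h; rewrite invr_gt0 ltr0n.
have E := Rintegral_FTC ab (fun t h => dD t (tp t h)) (fun t h => cd t (tp t h)).
have fin : (\int[mu]_(x in exhaust_itv n) (dominating c x)%:E \is a fin_num)%E.
  apply: integrable_fin_num => //.
  apply: continuous_compact_integrable; first exact: segment_compact.
  apply: continuous_in_subspaceT => x; rewrite inE /exhaust_itv /= in_itv /= => h.
  exact: cd (tp _ h).
rewrite -(fineK fin) lee_fin -[X in X <= _]/(Rintegral mu (exhaust_itv n) (dominating c)) E.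
have h1 : 0 < (1 + expR (c * ln n.+2%:R))^-1 by rewrite invr_gt0.
have h2 : (1 + expR (c * ln n.+2%:R^-1))^-1 <= 1.
  by rewrite invf_le1//; have := expR_gt0 (c * ln n.+2%:R^-1); lra.
by rewrite opprK; lra.
Qed.

End RealVariable.

(** * The Gamma function *)

Section GammaFunction.
Context {R : realType}.
Implicit Types (s z w : R[i]) (x y t : R) (D : set (measurableTypeR R)).
Local Notation Re := (@complex.Re R).
Local Notation Im := (@complex.Im R).
Local Notation normc := (@ComplexField.Normc.normc R).
Local Notation mu := (@lebesgue_measure R).
Local Notation halfline := (`]0%R, +oo[%classic : set (measurableTypeR R)).

Lemma dominating_ge (c t : R) : 0 < c -> 0 < t ->
  expR (- t) * expR ((c - 1) * ln t) <= 4 * expR `|(2 * c) * ln (2 * c)| / c * dominating c t.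
Proof.
move=> c0 t0; set K := expR `|_|.
have K1 : 1 <= K by rewrite /K -expR0 ler_expR.
set T := expR (c * ln t); have T0 : 0 < T by exact: expR_gt0.
have -> : expR ((c - 1) * ln t) = T / t by rewrite mulrDl mulN1r expRD expRN lnK.
(* If T = t^c <= 1, both factors are bounded trivially. Otherwise (1 + T)^2 <= 4 T^2, and T^2 =
   t^(2c) <= K e^t by [lnM_le] at 2c, whence the constant K. *)
have key : expR (- t) * (1 + T) ^+ 2 <= 4 * K.
  have et : 0 < expR (- t) by exact: expR_gt0.
  have [T1|T1] := leP T 1.
    have : expR (- t) <= 1 by rewrite -expR0 ler_expR oppr_le0 ltW.
    have : (1 + T) ^+ 2 <= 4 by nra.
    have : 0 <= (1 + T) ^+ 2 by exact: sqr_ge0.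
    by nra.
  have h1 : (1 + T) ^+ 2 <= 4 * T ^+ 2 by nra.
  have h2 : expR (- t) * T ^+ 2 <= K.
    rewrite /T -expRM_natl -expRD /K ler_expR.
    have := @lnM_le R (2 * c) t; rewrite mulr_gt0// => /(_ isT t0).
    by move: `|_| => x; lra.
  by nra.
rewrite /dominating -/T.
have D0 : 0 < (1 + T) ^+ 2 by rewrite exprn_gt0// addr_gt0.
have -> : 4 * K / c * (c * (T / t) / (1 + T) ^+ 2) = 4 * K / (1 + T) ^+ 2 * (T / t).
  by field; rewrite ?gt_eqF// addr_gt0.
apply: ler_wpM2r; first by rewrite ltW// divr_gt0.
by rewrite ler_pdivlMr.
Qed.

Lemma rintegrable_gamma x : -1 < x -> rintegrable halfline (fun t => expR (- t) * expR (x * ln t)).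
Proof.
move=> x1; have c0 : 0 < x + 1 by lra.
apply: (@le_rintegrable _ _ _
  (fun t => 4 * expR `|(2 * (x + 1)) * ln (2 * (x + 1))| / (x + 1) * dominating (x + 1) t)) => //.
- apply: measurable_funM.
    by apply: (measurableT_comp (@measurable_expR R)); exact: oppr_measurable.
  apply: (measurableT_comp (@measurable_expR R)); apply: measurable_funM => //.
  exact: measurable_funTS (@measurable_ln R).
- move=> t; rewrite /= in_itv /= andbT => t0.
  rewrite ger0_norm; last by rewrite mulr_ge0 ?expR_ge0.
  by have := dominating_ge c0 t0; rewrite addrK.
by apply: rintegrableZ => //; exact: rintegrable_dominating.
Qed.

Lemma Gamma_right_laplace s : Gamma_right s = laplace halfline (fun t => expR (- t)) (@ln R) 0 (s - 1).
Proof.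
rewrite /Gamma_right /laplace; apply: eq_cintegral => t _.
by rewrite /laplace_integrand expr0 mulr1 mulrC.
Qed.

(** The interval ]-1, Re s[ is an open strip of abscissas around Re s - 1, the point at which the
    transform is taken. *)
Let gamma_hyp s (x : R) : -1 < x < Re s -> rintegrable halfline (fun t => expR (- t) * expR (x * ln t)).
Proof. by move=> /andP[x1 _]; exact: rintegrable_gamma. Qed.

Let mexpN : measurable_fun halfline (fun t => expR (- t)).
Proof. by apply: (measurableT_comp (@measurable_expR R)); exact: oppr_measurable. Qed.

Let mln : measurable_fun halfline (@ln R).
Proof. exact: measurable_funTS (@measurable_ln R). Qed.

Lemma Gamma_right_integrable s : 0 < Re s ->
  cintegrable halfline (fun t => cpow t (s - 1) * (expR (- t))%:C).
Proof.
move=> s0; have h : -1 < Re (s - 1) < Re s by rewrite cReD cReN /=; lra.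
apply: eq_cintegrable (laplace_integrable (measurable_itv _) mexpN mln (@gamma_hyp s) 0 h) => //.
by move=> t _; rewrite /laplace_integrand expr0 mulr1 mulrC.
Qed.

Lemma smooth_Gamma_right s : 0 < Re s -> smooth_at (@Gamma_right R) s.
Proof.
move=> s0; have h : -1 < Re (s - 1) < Re s by rewrite cReD cReN /=; lra.
move=> n; have := smooth_laplace (measurable_itv _) mexpN mln (@gamma_hyp s) h n.
rewrite -[s in s - 1]mul1r => /smooth_affine; apply: smooth_near.
by near=> z; rewrite Gamma_right_laplace mul1r.
Unshelve. all: by end_near. Qed.

(** Integration by parts: the difference of the two integrands is, up to sign, the derivative of t^s
    e^(-t), which vanishes at both ends of the half-line. *)
Lemma Gamma_rightS s : 0 < Re s -> Gamma_right (s + 1) = s * Gamma_right s.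
Proof.
move=> s0.
have s1 : 0 < Re (s + 1) by rewrite cReD /=; lra.
have i1 := Gamma_right_integrable s0.
have i2 := Gamma_right_integrable s1.
apply/eqP; rewrite eq_sym -subr_eq0 -mulN1r -!cintegralZ// -cintegralD//;
  [|exact: cintegrableZ..].
apply/eqP; set f := (X in cintegral _ X).
pose F t := cpow t s * (expR (- t))%:C.
have dexp t : is_derive t 1 (fun x => expR (- x)) (- expR (- t)).
  apply: is_derive_eq (is_derive1_comp (is_derive_expR _) (is_deriveN (is_derive_id _ _))) _.
  by rewrite mulrN1.
have dF t : 0 < t -> is_rderive F t (f t).
  move=> t0; apply: is_rderive_eq (is_rderiveM (is_rderive_cpow s t0) (is_rderive_real (dexp t))) _.
  by rewrite /f addrK rmorphN /=; ring.
have df t : 0 < t -> exists d, is_rderive f t d.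
  move=> t0; eexists; apply: is_rderiveD.
    by apply: is_rderiveZ; exact: is_rderiveM (is_rderive_cpow _ t0) (is_rderive_real (dexp t)).
  by apply: is_rderiveZ; exact: is_rderiveM (is_rderive_cpow _ t0) (is_rderive_real (dexp t)).
have tp n t : n.+2%:R^-1 <= t <= n.+2%:R -> 0 < t.
  by move=> /andP[h _]; apply: lt_le_trans h; rewrite invr_gt0 ltr0n.
apply: (@cintegral_exhaust _ _ exhaust_itv) => //.
- by move=> n; exact: measurable_itv.
- by move=> n; exact: exhaust_itv_sub.
- by move=> x; rewrite /= in_itv /= andbT; exact: exhaust_itvP.
- by apply: cintegrableD => //; exact: cintegrableZ.
have E n : cintegral (exhaust_itv n) f = F n.+2%:R - F n.+2%:R^-1.
  apply: cintegral_FTC; first exact: exhaust_itv_lt.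
    by move=> t /tp; exact: dF.
  by move=> t /tp; exact: df.
have c1 : 0 < Re s + 1 by lra.
(* With N = n + 2, [lnM_le] at Re s + 1 gives N^(Re s) e^(-N) <= e^K / N at the upper end; at the
   lower end 1/N the boundary term is at most N^(-Re s). *)
set K := `|(Re s + 1) * ln (Re s + 1)|.
apply: (@squeeze_cvgr _ _ _ _ (fun=> 0) (fun n : nat =>
   expR K * expR (- (1 * ln n.+2%:R)) + expR (- (Re s * ln n.+2%:R)))).
- apply: nearW => n; apply/andP; split; first exact: normc_ge0.
  rewrite E subr0.
  apply: (le_trans (normcD _ _)); rewrite normcN; apply: lerD.
    rewrite /F normcM normc_cpow normc_real (ger0_norm (expR_ge0 _)) -!expRD ler_expR.
    have := @lnM_le R (Re s + 1) n.+2%:R c1; rewrite ltr0n -/K => /(_ isT); lra.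
  rewrite /F normcM normc_cpow normc_real (ger0_norm (expR_ge0 _)) -!expRD ler_expR.
  rewrite lnV ?posrE ?ltr0n// mulrN.
  have : 0 < n.+2%:R^-1 :> R by rewrite invr_gt0.
  by move=> /ltW; rewrite gerDl oppr_le0.
- exact: cvg_cst.
- rewrite -[X in _ --> X](addr0 (0 : R)); apply: cvgD; last exact: cvg_expRN_ln.
  rewrite -[X in _ --> X](mulr0 (expR K)); apply: cvgM; first exact: cvg_cst.
  exact: cvg_expRN_ln.
Qed.

Lemma Gamma_right1 : Gamma_right 1 = 1 :> R[i].
Proof.
have i1 : cintegrable halfline (fun t => cpow t (1 - 1) * (expR (- t))%:C).
  by apply: Gamma_right_integrable => /=.
rewrite /Gamma_right.
have E1 t : cpow t (1 - 1) * (expR (- t))%:C = (expR (- t))%:C :> R[i].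
  by rewrite subrr /cpow mul0r cexp0 mul1r.
pose F t : R[i] := (- expR (- t))%:C.
have dexp t : is_derive t 1 (fun x => expR (- x)) (- expR (- t)).
  apply: is_derive_eq (is_derive1_comp (is_derive_expR _) (is_deriveN (is_derive_id _ _))) _.
  by rewrite mulrN1.
set f := (X in cintegral _ X).
apply: (@cintegral_exhaust _ _ exhaust_itv) => //.
- by move=> n; exact: measurable_itv.
- by move=> n; exact: exhaust_itv_sub.
- by move=> x; rewrite /= in_itv /= andbT; exact: exhaust_itvP.
have E n : cintegral (exhaust_itv n) f = F n.+2%:R - F n.+2%:R^-1.
  apply: cintegral_FTC; first exact: exhaust_itv_lt.
    move=> t _; rewrite /f E1; apply: is_rderive_eq (is_rderive_real (is_deriveN (dexp t))) _.
    by rewrite opprK.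
  move=> t _; rewrite /f; exists (- expR (- t))%:C.
  by under eq_fun do rewrite E1; exact: is_rderive_real.
(* With N = n + 2, the two errors are e^(-N) <= 1/N and |e^(-1/N) - 1| <= e/N. *)
apply: (@squeeze_cvgr _ _ _ _ (fun=> 0) (fun n : nat =>
   expR (- (1 * ln n.+2%:R)) + expR 1 * expR (- (1 * ln n.+2%:R)))).
- apply: nearW => n; apply/andP; split; first exact: normc_ge0.
  have -> : cintegral (exhaust_itv n) f - 1 =
      (- expR (- n.+2%:R) - - expR (- n.+2%:R^-1) - 1)%:C.
    by rewrite E /F !rmorphB.
  rewrite normc_real.
  have -> : - expR (- n.+2%:R) - - expR (- n.+2%:R^-1) - 1 =
      - expR (- n.+2%:R) + (expR (- n.+2%:R^-1) - 1) :> R by ring.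
  apply: (le_trans (ler_normD _ _)); apply: lerD.
    rewrite normrN (ger0_norm (expR_ge0 _)) ler_expR lerN2 mul1r.
    by apply/ltW/ln_sublinear.
  apply: (le_trans (expR_sub1_le _)).
  rewrite normrN ger0_norm ?invr_ge0// mulrC mul1r expRN lnK ?posrE//.
  by rewrite ler_wpM2r ?invr_ge0// ler_expR invf_le1// ler1n.
- exact: cvg_cst.
- rewrite -[X in _ --> X](addr0 (0 : R)); apply: cvgD; first exact: cvg_expRN_ln.
  rewrite -[X in _ --> X](mulr0 (expR 1)); apply: cvgM; first exact: cvg_cst.
  exact: cvg_expRN_ln.
Qed.

(* Substituting [t = x ^ 2] turns the integral into the Gauss integral. *)
Lemma Gamma_right_half : Gamma_right (2^-1) = (Num.sqrt pi)%:C :> R[i].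
Proof.
pose H t : R := expR (- 2^-1 * ln t) * expR (- t).
have e1 : (2^-1 - 1 : R[i]) = (- 2^-1 : R)%:C by rewrite rmorphN /= fmorphV rmorph_nat; field.
have E1 t : cpow t (2^-1 - 1) * (expR (- t))%:C = (H t)%:C :> R[i].
  by rewrite e1 /cpow -rmorphM /= cexp_real -rmorphM.
have -> : Gamma_right (2^-1 : R[i]) = (Rintegral mu halfline H)%:C.
  rewrite /Gamma_right; under eq_cintegral do rewrite E1.
  rewrite /cintegral /=; congr (_ +i* _).
  by rewrite Rintegral_cst//= mul0r.
congr (_ %:C).
have iH : rintegrable halfline H.
  have hx : -1 < - 2^-1 :> R by lra.
  by apply: eq_rintegrable (rintegrable_gamma hx) => // t _; rewrite mulrC.
have iG : rintegrable halfline gauss_fun by exact: integrableS (@integrableT_gauss R).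
(* The image of [exhaust_itv n] under squaring; it stays away from 0, where H is unbounded. *)
pose E n : set (measurableTypeR R) := `[n.+2%:R^-1 ^+ 2, n.+2%:R ^+ 2]%classic.
have dsq : derive1 (fun x : R => x ^+ 2) = (fun x => 2 *: x).
  by apply/funext => y; rewrite exp_derive1 /= expr1.
have E2 n : Rintegral mu (E n) H = Rintegral mu (exhaust_itv n) (fun x => 2 * gauss_fun x).
  have ab := exhaust_itv_lt (R := R) n.
  have a0 : 0 < n.+2%:R^-1 :> R by rewrite invr_gt0.
  rewrite /Rintegral /E; congr fine.
  rewrite (@integration_by_substitution_increasing R (fun x => x ^+ 2) H _ _ (ltW ab)).
  - apply: eq_integral => x; rewrite inE /exhaust_itv /= in_itv /= => /andP[ax xb].
    have x0 : 0 < x by exact: lt_le_trans ax.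
    rewrite fctE /= exp_derive1 /H /gauss_fun lnXn// -[ln x *+ 2]mulr_natr.
    rewrite (_ : - 2^-1 * (ln x * 2%:R) = - ln x); last by field.
    rewrite expRN lnK// expr1 /GRing.scale /=; congr EFin; field.
    by rewrite gt_eqF.
  - move=> x y; rewrite !in_itv /= => /andP[ax xb] /andP[ay yb] xy.
    by rewrite ltr_pXn2r// nnegrE ltW// (lt_le_trans a0).
  - move=> x _; rewrite dsq; exact: scaler_continuous.
  - rewrite dsq; apply/cvg_ex; exists (2 *: n.+2%:R^-1).
    by apply: cvg_at_right_filter; exact: scaler_continuous.
  - rewrite dsq; apply/cvg_ex; exists (2 *: n.+2%:R).
    by apply: cvg_at_left_filter; exact: scaler_continuous.
  - split.
    + by move=> x _; exact: exprn_derivable.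
    + by apply: cvg_at_right_filter; exact: exprn_continuous.
    + by apply: cvg_at_left_filter; exact: exprn_continuous.
  - apply: continuous_in_subspaceT => x; rewrite inE /= in_itv /= => /andP[ax _].
    have x0 : 0 < x by apply: lt_le_trans ax; rewrite exprn_gt0.
    apply: cvgM.
      apply: continuous_comp; last exact: continuous_expR.
      by apply: cvgM; [exact: cvg_cst|exact: continuous_ln].
    apply: continuous_comp; last exact: continuous_expR.
    exact: continuousN.
have c1 : Rintegral mu (exhaust_itv n) (fun x => 2 * gauss_fun x) @[n --> \oo] --> Num.sqrt pi.
  suff <- : Rintegral mu halfline (fun x => 2 * gauss_fun x) = Num.sqrt pi :> R.
    apply: Rintegral_exhaust => //.
    - by move=> n; exact: measurable_itv.
    - exact: exhaust_itv_sub.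
    - by move=> x; rewrite /= in_itv /= andbT; exact: exhaust_itvP.
    - exact: rintegrableZ.
  rewrite RintegralZl//.
  rewrite Rintegral_itv_obnd_cbnd; last exact: iG.
  by rewrite /Rintegral integral0y_gauss /=; field.
have c2 : Rintegral mu (E n) H @[n --> \oo] --> Rintegral mu halfline H.
  apply: Rintegral_exhaust => //.
  - by move=> n; exact: measurable_itv.
  - move=> n x; rewrite /E /= !in_itv /= => /andP[h _]; rewrite andbT.
    by apply: lt_le_trans h; rewrite exprn_gt0.
  - move=> x; rewrite /= in_itv /= andbT => x0.
    apply: filterS (exhaust_itvP x0) => n; rewrite /E /exhaust_itv /= !in_itv /= => /andP[h1 h2].
    apply/andP; split.
      apply: le_trans h1; rewrite expr2 ler_piMl ?invr_ge0//.
      by rewrite invf_le1// ler1n.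
    by apply: (le_trans h2); rewrite expr2 ler_peMl// ler1n.
have c3 : Rintegral mu (exhaust_itv n) (fun x => 2 * gauss_fun x) @[n --> \oo] -->
    Rintegral mu halfline H.
  by apply: cvg_trans c2; apply: near_eq_cvg; apply: nearW => n; exact: E2.
exact: cvg_unique c3 c1.
Qed.

End GammaFunction.

(** * Values of Gamma at integers and half-integers *)

Section GammaValues.
Context {R : realType}.
Implicit Types (s z w : R[i]) (x y t : R).
Local Notation Re := (@complex.Re R).
Local Notation Im := (@complex.Im R).

Let Gamma_right_shift z m d : 0 < Re z + m%:R ->
  (forall j, (j < m + d)%N -> z + j%:R != 0) ->
  Gamma_right (z + (m + d)%N%:R) / \prod_(j < m + d) (z + j%:R) =
  Gamma_right (z + m%:R) / \prod_(j < m) (z + j%:R).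
Proof.
move=> zm; elim: d => [|d IH] nz; first by rewrite addn0.
rewrite -IH; last by move=> j jd; apply: nz; rewrite addnS ltnS ltnW.
rewrite addnS big_ord_recr /= -[(m + d).+1%:R]natr1 addrA Gamma_rightS; last first.
  by rewrite cReD cRe_nat natrD addrA ltr_wpDr.
have h : z + (m + d)%:R != 0 by apply: nz; rewrite addnS.
by rewrite invfM [_^-1 * (_)^-1]mulrC mulrA [_ * Gamma_right _]mulrC -mulrA mulrA mulfK// mulrC.
Qed.

(** Beyond the least shift m, each further step multiplies numerator and denominator by the same
    nonzero factor. A fixed M can thus be used on a neighbourhood where m jumps. *)
Lemma Gamma_shift z (M : nat) : 0 < Re z + M%:R ->
  (forall j, (j < M)%N -> z + j%:R != 0) ->
  Gamma z = Gamma_right (z + M%:R) / \prod_(j < M) (z + j%:R).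
Proof.
move=> zM nz; rewrite /Gamma; set m := if _ then _ else _.
have [m0 mM] : 0 < Re z + m%:R /\ (m <= M)%N.
  rewrite /m; case: ifPn => [h|]; first by rewrite addr0.
  rewrite -leNgt => z0; split; first by have := truncnS_gt (- Re z); lra.
  by rewrite truncn_lt_nat ?oppr_ge0//; lra.
by rewrite -(Gamma_right_shift m0 (d := M - m)) ?subnKC.
Qed.

Lemma Gamma_rightE z : 0 < Re z -> Gamma z = Gamma_right z.
Proof.
by move=> z0; rewrite (@Gamma_shift z 0) ?addr0// big_ord0 divr1.
Qed.

Lemma Gamma_right_nat n : Gamma_right n.+1%:R = (n`!)%:R :> R[i].
Proof.
elim: n => [|n IH]; first by rewrite Gamma_right1.
by rewrite -[n.+2%:R]natr1 Gamma_rightS ?cRe_nat// IH -natrM factS.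
Qed.

Lemma Gamma_right_half_nat n : Gamma_right (2^-1 + n%:R) =
  ((2 * n)`!)%:R / (4 ^+ n * (n`!)%:R) * (Num.sqrt pi)%:C :> R[i].
Proof.
elim: n => [|n IH]; first by rewrite addr0 Gamma_right_half muln0 fact0 expr0 mul1r divff ?mul1r ?oner_eq0.
have Re0 : Re 2^-1 = 2^-1.
  by rewrite -[2%:R in LHS]/((2%:R : R[i])) natrC -fmorphV.
rewrite -[n.+1%:R]natr1 addrA Gamma_rightS; last first.
  by rewrite cReD cRe_nat Re0 ltr_wpDr// invr_gt0.
rewrite IH (_ : (2 * n.+1)%N = (2 * n).+2); last by rewrite mulnS.
rewrite !factS !natrM exprS -[n.+1%:R]natr1 -[(2 * n).+2%:R]natr1 -[(2 * n).+1%:R]natr1 natrM.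
have n1 : n%:R + 1 != 0 :> R[i] by rewrite natr1 pnatr_eq0.
have nf : (n`!)%:R != 0 :> R[i] by rewrite pnatr_eq0 -lt0n fact_gt0.
have n4 : 4 ^+ n != 0 :> R[i] by rewrite expf_neq0// pnatr_eq0.
by field; rewrite n1 nf n4.
Qed.

(** The denominator of Gamma((1 - s) / 2) at s = 2n, where the argument is 1/2 - n and the shifted
    one is 1/2. *)
Lemma prod_half_shift n : \prod_(j < n) (2^-1 - n%:R + j%:R) =
  (-1) ^+ n * ((2 * n)`!)%:R / (4 ^+ n * (n`!)%:R) :> R[i].
Proof.
elim: n => [|n IH]; first by rewrite big_ord0 muln0 fact0 !expr0 !mul1r invr1.
rewrite big_ord_recl /= (eq_bigr (fun j : 'I_n => 2^-1 - n%:R + j%:R)); last first.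
  by move=> j _; rewrite /bump /= natrD -[n.+1%:R]natr1; ring.
rewrite IH (_ : (2 * n.+1)%N = (2 * n).+2); last by rewrite mulnS.
rewrite !factS !natrM !exprS -[n.+1%:R]natr1 -[(2 * n).+2%:R]natr1 -[(2 * n).+1%:R]natr1 natrM.
have n1 : n%:R + 1 != 0 :> R[i] by rewrite natr1 pnatr_eq0.
have nf : (n`!)%:R != 0 :> R[i] by rewrite pnatr_eq0 -lt0n fact_gt0.
have n4 : 4 ^+ n != 0 :> R[i] by rewrite expf_neq0// pnatr_eq0.
by field; rewrite n1 nf n4.
Qed.

(** At s = 2n + 1 the argument (1 - s) / 2 is -n. The product stops before the vanishing factor j =
    n, so its inverse is the residue of Gamma at -n. *)
Lemma prod_nat_shift n : \prod_(j < n) (- n%:R + j%:R) = (-1) ^+ n * (n`!)%:R :> R[i].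
Proof.
elim: n => [|n IH]; first by rewrite big_ord0 fact0 expr0 mul1r.
rewrite big_ord_recl /= (eq_bigr (fun j : 'I_n => - n%:R + j%:R)); last first.
  by move=> j _; rewrite /bump /= natrD -[n.+1%:R]natr1; ring.
by rewrite IH factS natrM exprS -[n.+1%:R]natr1; ring.
Qed.

End GammaValues.

(** * The zeta function *)

Section ZetaFunction.
Context {R : realType}.
Implicit Types (s z w : R[i]) (x y t : R) (D : set (measurableTypeR R)).
Local Notation Re := (@complex.Re R).
Local Notation Im := (@complex.Im R).
Local Notation normc := (@ComplexField.Normc.normc R).
Local Notation mu := (@lebesgue_measure R).
Local Notation ray := (`[1%R, +oo[%classic : set (measurableTypeR R)).

Definition fracpart (x : R) : R := x - (Num.floor x)%:~R.

Lemma fracpart_ge0 x : 0 <= fracpart x.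
Proof. by rewrite /fracpart subr_ge0 floor_le_tmp. Qed.

Lemma fracpart_le1 x : fracpart x <= 1.
Proof. by have := floorD1_gt x; rewrite /fracpart intrD => h; lra. Qed.

Let mfrac : measurable_fun ray fracpart.
Proof.
apply: measurable_funB => //.
apply: (@nondecreasing_measurable R) => //.
by move=> x y xy; rewrite ler_int le_floor.
Qed.

Let mln : measurable_fun ray (@ln R).
Proof. exact: measurable_funTS (@measurable_ln R). Qed.

Lemma rintegrable_zeta x : x < -1 -> rintegrable ray (fun t => fracpart t * expR (x * ln t)).
Proof.
(* This c makes t^x = 1 / (T t) with T = t^c. As T >= 1 on the ray, (1 + T)^2 <= 4 T^2 gives the
   domination. *)
move=> x1; set c := - x - 1; have c0 : 0 < c by rewrite /c; lra.
apply: (@le_rintegrable _ _ _ (fun t => 4 / c * dominating c t)) => //.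
- apply: measurable_funM => //.
  by apply: (measurableT_comp (@measurable_expR R)); exact: measurable_funM.
- move=> t; rewrite /= in_itv /= andbT => t1.
  have t0 : 0 < t by exact: lt_le_trans t1.
  rewrite ger0_norm; last by rewrite mulr_ge0 ?expR_ge0 ?fracpart_ge0.
  apply: (@le_trans _ _ (expR (x * ln t))).
    by rewrite ler_piMl ?expR_ge0 ?fracpart_le1.
  rewrite /dominating; set T := expR (c * ln t).
  have T1 : 1 <= T by rewrite /T -expR0 ler_expR mulr_ge0 ?(ltW c0)// ln_ge0.
  have -> : expR (x * ln t) = T^-1 / t.
    by rewrite (_ : x = - c - 1) /c ?mulrBl ?mul1r ?expRD ?expRN ?mulNr ?expRN ?lnK//; ring.
  have T0 : 0 < T by lra.
  have -> : 4 / c * (c * (T / t) / (1 + T) ^+ 2) = 4 * T / (1 + T) ^+ 2 / t.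
    by field; rewrite !gt_eqF// addr_gt0.
  rewrite ler_wpM2r ?invr_ge0 ?(ltW t0)//.
  rewrite ler_pdivlMr ?exprn_gt0 ?addr_gt0// mulrC ler_pdivrMr//.
  by nra.
apply: rintegrableZ => //; apply: (@integrableS _ _ _ mu `]0, +oo[) => //; last exact: rintegrable_dominating.
by move=> t; rewrite /= !in_itv /= !andbT => t1; exact: lt_le_trans t1.
Qed.

Definition zeta_integrand s (x : R) : R[i] := (fracpart x)%:C * cpow x (- s - 1).

Lemma zeta_integrand_laplace s t : laplace_integrand fracpart (@ln R) 0 (- s - 1) t = zeta_integrand s t.
Proof. by rewrite /laplace_integrand expr0 mulr1. Qed.

Let zeta_hyp s (x : R) : - Re s - 2 < x < -1 -> rintegrable ray (fun t => fracpart t * expR (x * ln t)).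
Proof. by move=> /andP[_ x1]; exact: rintegrable_zeta. Qed.

Lemma zeta_integrable s : 0 < Re s -> cintegrable ray (zeta_integrand s).
Proof.
move=> s0; have h : - Re s - 2 < Re (- s - 1) < -1 by rewrite cReD !cReN /=; lra.
apply: eq_cintegrable (laplace_integrable (measurable_itv _) mfrac mln (@zeta_hyp s) 0 h) => //.
by move=> t _; exact: zeta_integrand_laplace.
Qed.

Lemma smooth_zeta_integral s : 0 < Re s -> smooth_at (fun z => cintegral ray (zeta_integrand z)) s.
Proof.
move=> s0; have h : - Re s - 2 < Re (- s - 1) < -1 by rewrite cReD !cReN /=; lra.
move=> n; have := smooth_laplace (measurable_itv _) mfrac mln (@zeta_hyp s) h n.
rewrite -[- s]mulN1r => /smooth_affine; apply: smooth_near.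
near=> z; rewrite /laplace mulN1r; apply: eq_cintegral => t _.
exact: zeta_integrand_laplace.
Unshelve. all: by end_near. Qed.

Lemma cintegral_cat (a b c : R) (f : R -> R[i]) : a <= b -> b <= c ->
  cintegrable `[a, c] f ->
  cintegral `[a, c] f = cintegral `[a, b] f + cintegral `[b, c] f.
Proof.
move=> ab bc [f1 f2].
have H (g : R -> R) : rintegrable `[a, c] g ->
    Rintegral mu `[a, c] g = Rintegral mu `[a, b] g + Rintegral mu `[b, c] g.
  move=> ig.
  have := @Rintegral_itvB R g (BLeft a) (BRight c) b ig; rewrite !bnd_simp ab bc => /(_ isT isT) E.
  have ig' : rintegrable `]b, c] g by apply: integrableS ig => //; apply: subset_itvr; rewrite bnd_simp.
  by rewrite -(Rintegral_itv_obnd_cbnd ig') -E addrC subrK.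
by apply: complex_ext; rewrite ?(cReD, cImD) /=; exact: H.
Qed.

(** The right endpoint is left out because the fractional part falls back to 0 there, while x - a
    does not. *)
Lemma cintegral_eq_co (a b : R) (f g : R -> R[i]) :
  cintegrable `[a, b] f -> (forall x, a <= x < b -> f x = g x) ->
  cintegral `[a, b] f = cintegral `[a, b] g.
Proof.
move=> [f1 f2] fg.
have H (h k : R -> R) : rintegrable `[a, b] h -> (forall x, a <= x < b -> h x = k x) ->
    Rintegral mu `[a, b] h = Rintegral mu `[a, b] k.
  move=> ih hk.
  have ih' : rintegrable `[a, b[ h by apply: integrableS ih => //; apply: subset_itvl; rewrite bnd_simp.
  have hk' x : (`[a, b[%classic : set (measurableTypeR R)) x -> h x = k x.
    by rewrite /= in_itv /=; exact: hk.
  rewrite -[LHS]Rintegral_itv_bndo_bndc// -[RHS]Rintegral_itv_bndo_bndc//; last exact: eq_rintegrable ih'.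
  by apply: eq_Rintegral => x; rewrite inE => /hk'.
by apply: complex_ext; apply: H => // x /fg ->.
Qed.

(** Between consecutive integers the fractional part is x minus a constant, so the integrand has an
    elementary primitive; the contributions telescope except for the terms of the Dirichlet
    series. *)
Lemma zeta_partial s N : 0 < Re s -> s != 1 ->
  s * cintegral (`[1, N.+1%:R]%classic) (zeta_integrand s) =
  (cpow N.+1%:R (1 - s) - 1) / (1 - s) + 1 - \sum_(n < N.+1) cpow n.+1%:R (- s).
Proof.
move=> s0 s1; have s1' : 1 - s != 0 by rewrite subr_eq0 eq_sym.
have sn0 : s != 0 by apply: contraTneq s0 => ->; rewrite ltxx.
have ss (t : R) : 0 < t -> cpow t (1 - s) = t%:C * cpow t (- s).
  by move=> t0; rewrite /cpow mulrDl mul1r cexpD cexp_real lnK.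
elim: N => [|N IH].
  rewrite (_ : cintegral _ _ = 0); last by rewrite set_itv1 /cintegral !Rintegral_set1.
  by rewrite big_ord1 /cpow ln1 !mulr0 !cexp0 subrr mul0r add0r subrr.
have ii (a b : R) : 1 <= a -> cintegrable `[a, b] (zeta_integrand s).
  move=> a1; apply: cintegrableS (zeta_integrable s0) => //.
  move=> t; rewrite /= !in_itv /= andbT => /andP[h _]; exact: le_trans h.
rewrite (@cintegral_cat _ N.+1%:R); [|by rewrite ler1n|by rewrite ler_nat|exact: ii].
rewrite mulrDr IH [in RHS]big_ord_recr /=.
suff -> : s * cintegral `[N.+1%:R, N.+2%:R] (zeta_integrand s) =
  (cpow N.+2%:R (1 - s) - 1) / (1 - s) - (cpow N.+1%:R (1 - s) - 1) / (1 - s) - cpow N.+2%:R (- s).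
  by move: (\sum_(_ < _) _) => S; ring.
set a : R := N.+1%:R; set b : R := N.+2%:R.
have a0 : 0 < a by rewrite ltr0n.
have b0 : 0 < b by rewrite ltr0n.
have ab : b = a + 1 by rewrite /a /b natr1.
rewrite (@cintegral_eq_co _ _ _ (fun x => (x - a)%:C * cpow x (- s - 1))); first last.
- move=> x /andP[ax xb]; rewrite /zeta_integrand /fracpart.
  suff -> : Num.floor x = N.+1%:Z by [].
  by apply: floor_def; rewrite ax /= intrD1 -ab.
- by apply: ii; rewrite ler1n.
(* Primitive of (x - a) x^(-s-1) = x^(-s) - a x^(-s-1). *)
pose F (x : R) := cpow x (1 - s) / (1 - s) + a%:C * (cpow x (- s) / s).
rewrite (@cintegral_FTC _ F); first last.
- move=> t /andP[h _]; have t0 : 0 < t by exact: lt_le_trans h.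
  have da : is_derive t 1 (fun x : R => x - a) (1 - 0) by exact: is_deriveB.
  by eexists; apply: is_rderiveM (is_rderive_real da) (is_rderive_cpow _ t0).
- move=> t /andP[h _]; have t0 : 0 < t by exact: lt_le_trans h.
  rewrite /F; under eq_fun do rewrite ![_ / _]mulrC.
  apply: is_rderive_eq (is_rderiveD (is_rderiveZ _ (is_rderive_cpow _ t0))
    (is_rderiveZ _ (is_rderiveZ _ (is_rderive_cpow _ t0)))) _.
  rewrite !cpow_subr1// ss// fmorphV rmorphB /=.
  have tn : t%:C != 0 by rewrite fmorph_eq0 gt_eqF.
  by field; rewrite tn s1' sn0.
- by rewrite ab ltrDl.
rewrite /F !ss// ab rmorphD /= rmorph1.
by field; rewrite s1' sn0.
Qed.

Lemma cvg_cintegral_exhaust D (E : (set (measurableTypeR R))^nat) (f : R -> R[i]) :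
  measurable D -> (forall n, measurable (E n)) -> (forall n, E n `<=` D) ->
  (forall x, D x -> \forall n \near \oo, E n x) -> cintegrable D f ->
  normc (cintegral (E n) f - cintegral D f) @[n --> \oo] --> (0 : R).
Proof.
move=> mD mE ED DE [f1 f2].
have h1 := Rintegral_exhaust mD mE ED DE f1.
have h2 := Rintegral_exhaust mD mE ED DE f2.
have z (u : nat -> R) l : u n @[n --> \oo] --> l -> `|u n - l| @[n --> \oo] --> (0 : R).
  move=> ul; rewrite -(normr0 R); apply: cvg_norm.
  by rewrite -(subrr l); apply: cvgB ul (cvg_cst _).
apply: (@squeeze_cvgr _ _ _ _ (fun=> 0) _ _ _ _ (cvg_cst _)); last first.
  by rewrite -[X in _ --> X](addr0 (0 : R)); apply: cvgD (z _ _ h1) (z _ _ h2).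
apply: nearW => n; apply/andP; split; first exact: normc_ge0.
by apply: le_trans (normc_ReIm _) _; rewrite cReD cImD cReN cImN.
Qed.

Lemma cvg_complexP (u : nat -> R[i]) l : normc (u n - l) @[n --> \oo] --> (0 : R) ->
  (u : (R[i]^o)^nat) @ \oo --> (l : R[i]^o).
Proof.
move=> H; apply/cvgrPdist_lt => /= e e0.
(* In the partial order of [R[i]], a positive element is real. *)
have [e1 e2] : 0 < Re e /\ e = (Re e)%:C.
  by move: e0; rewrite ltcE => /andP[/eqP /= h1 h2]; split => //; apply: complex_ext => /=.
move/cvgrPdist_lt : H => /(_ _ e1); apply: filterS => n.
by rewrite sub0r normrN ger0_norm ?normc_ge0// distrC normE [X in _ -> _ < X]e2 ltcR.
Qed.

Lemma zeta_series s : 1 < Re s ->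
  (series (fun n => cpow n.+1%:R (- s)) : (R[i]^o)^nat) @ \oo -->
  (s / (s - 1) - s * cintegral ray (zeta_integrand s) : R[i]^o).
Proof.
move=> s1; have s0 : 0 < Re s by lra.
have sn1 : s != 1 by apply: contraTneq s1 => ->; rewrite ltxx.
have s1' : 1 - s != 0 by rewrite subr_eq0 eq_sym.
(* After two shifts the n-th partial sum ends with the term of n + 2, matching the integral over
   [1, n + 2]. The boundary term (n + 2)^(1 - s) / (1 - s) tends to 0 because Re s > 1. *)
rewrite -cvg_shiftS -cvg_shiftS; apply: cvg_complexP.
have P n : series (fun n => cpow n.+1%:R (- s)) n.+2 =
    (cpow n.+2%:R (1 - s) - 1) / (1 - s) + 1 -
    s * cintegral (`[1, n.+2%:R]%classic) (zeta_integrand s).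
  by rewrite zeta_partial// /series /= big_mkord; ring.
have c := @cvg_cintegral_exhaust ray (fun n => `[1, n.+2%:R]%classic) _ (measurable_itv _)
  (fun n => measurable_itv _) _ _ (zeta_integrable s0).
apply: (@squeeze_cvgr _ _ _ _ (fun=> 0) (fun n : nat => normc (1 - s)^-1 * expR (- ((Re s - 1) * ln n.+2%:R)) +
  normc s * normc (cintegral (`[1, n.+2%:R]%classic) (zeta_integrand s) - cintegral ray (zeta_integrand s)))).
- apply: nearW => n; apply/andP; split; first exact: normc_ge0.
  rewrite [X in normc (X - _)](P n); set J := cintegral ray _; set I := cintegral _ _.
  rewrite (_ : _ - _ - _ = (1 - s)^-1 * cpow n.+2%:R (1 - s) + - (s * (I - J))); last first.
    by field; rewrite s1' subr_eq0.
  apply: le_trans (normcD _ _) _; rewrite normcN (normcM (1 - s)^-1 (cpow _ _)) normc_cpow (normcM s) lerD// ler_wpM2l ?normc_ge0//.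
  by rewrite cReD cReN /= -mulNr opprB.
- exact: cvg_cst.
- rewrite -[X in _ --> X](addr0 (0 : R)); apply: cvgD.
    rewrite -[X in _ --> X](mulr0 (normc (1 - s)^-1)); apply: cvgM; first exact: cvg_cst.
    by apply: cvg_expRN_ln; rewrite subr_gt0.
  rewrite -[X in _ --> X](mulr0 (normc s)); apply: cvgM; first exact: cvg_cst.
  apply: c.
    by move=> n; apply: subset_itvl.
  move=> x; rewrite /= in_itv /= andbT => x1; near=> n.
  rewrite /= in_itv /= x1 /=.
  apply: (@le_trans _ _ n%:R); last by rewrite ler_nat -addn2 leq_addr.
  by near: n; exact: nbhs_infty_ger.
Unshelve. all: by end_near. Qed.

(** By [zeta_series] the Dirichlet series takes the same value as the integral formula, so the case
    distinction at Re s = 1 disappears. *)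
Lemma zetaE s : 0 < Re s ->
  zeta s = s / (s - 1) - s * cintegral ray (zeta_integrand s).
Proof.
move=> s0; rewrite /zeta s0 /zeta_right; case: ifPn => // s1.
exact: (cvg_lim (@norm_hausdorff _ R[i]^o) (zeta_series s1)).
Qed.

End ZetaFunction.

(** * Poles, and the tangent *)

Section SmoothAt.
Context {K : numFieldType}.
Implicit Types (f g : K -> K) (s : K).

Lemma smooth_at_near f g s : (\forall z \near (s : K^o), f z = g z) -> smooth_at f s -> smooth_at g s.
Proof. by move=> fg sf n; exact: smooth_near fg (sf n). Qed.

Lemma smooth_at_cst (c : K) s : smooth_at (fun=> c) s.
Proof. by move=> n; exact: smooth_cst. Qed.

Lemma smooth_at_id s : smooth_at id s.
Proof. by move=> n; exact: smooth_id. Qed.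

Lemma smooth_atD f g s : smooth_at f s -> smooth_at g s -> smooth_at (fun z => f z + g z) s.
Proof. by move=> sf sg n; exact: smoothD. Qed.

Lemma smooth_atM f g s : smooth_at f s -> smooth_at g s -> smooth_at (fun z => f z * g z) s.
Proof. by move=> sf sg n; exact: smoothM. Qed.

Lemma smooth_atN f s : smooth_at f s -> smooth_at (fun z => - f z) s.
Proof.
move=> sf; apply: (@smooth_at_near (fun z => -1 * f z)).
  by near=> z; rewrite mulN1r.
exact: smooth_atM (smooth_at_cst _ _) sf.
Unshelve. all: by end_near. Qed.

Lemma smooth_atB f g s : smooth_at f s -> smooth_at g s -> smooth_at (fun z => f z - g z) s.
Proof. by move=> sf sg; exact: smooth_atD sf (smooth_atN sg). Qed.

Lemma smooth_atV f s : smooth_at f s -> f s != 0 -> smooth_at (fun z => (f z)^-1) s.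
Proof. by move=> sf fs n; exact: smoothV. Qed.

Lemma smooth_atX f s n : smooth_at f s -> smooth_at (fun z => f z ^+ n) s.
Proof.
move=> sf; elim: n => [|n IH]; first exact: smooth_at_cst.
apply: (@smooth_at_near (fun z => f z * f z ^+ n)); last exact: smooth_atM.
by near=> z; rewrite exprS.
Unshelve. all: by end_near. Qed.

Lemma smooth_at_prod n (f : nat -> K -> K) s : (forall j, smooth_at (f j) s) ->
  smooth_at (fun z => \prod_(j < n) f j z) s.
Proof.
move=> sf; elim: n => [|n IH].
  apply: (@smooth_at_near (fun=> 1)); last exact: smooth_at_cst.
  by near=> z; rewrite big_ord0.
apply: (@smooth_at_near (fun z => (\prod_(j < n) f j z) * f n z)); last exact: smooth_atM.
by near=> z; rewrite big_ord_recr.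
Unshelve. all: by end_near. Qed.

Lemma smooth_at_affine f (a b t s : K) : a * s + b = t -> smooth_at f t ->
  smooth_at (fun z => f (a * z + b)) s.
Proof. by move=> <- sf n; exact: smooth_affine. Qed.

Lemma smooth_at_cvg_punctured f g s l : (\forall z \near (s : K^o), z != s -> f z = g z) ->
  smooth_at g s -> g s = l -> (f z : K^o) @[z --> (s : K^o)^'] --> (l : K^o).
Proof.
move=> fg sg <-.
have h : (g z : K^o) @[z --> (s : K^o)^'] --> (g s : K^o).
  by apply/(@continuous_withinNx K^o K^o g s); exact: smooth_at_continuous.
apply: cvg_trans h; apply: near_eq_cvg; rewrite /dnbhs near_withinE.
by apply: nearS fg => z h zs; rewrite h.
Qed.

Lemma is_cderive_subX (c : K) p z : is_cderive (fun x => (x - c) ^+ p) z (p%:R * (z - c) ^+ p.-1).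
Proof.
have d1 : is_cderive (fun x => x - c) z 1.
  by apply: is_cderive_eq (is_cderiveD (is_cderive_id z) (is_cderive_cst (- c) z)) _; rewrite addr0.
elim: p => [|p IH]; first by rewrite mul0r; exact: is_cderive_cst.
apply: (@is_cderive_near _ (fun x => (x - c) * (x - c) ^+ p)).
  by near=> x; rewrite exprS.
apply: is_cderive_eq (is_cderiveM d1 IH) _.
by case: p {IH} => [|p] /=; rewrite ?mul0r ?mulr0 ?addr0 ?exprS -?[p.+2%:R]natr1; ring.
Unshelve. all: by end_near. Qed.

Lemma near_neq (s z : K) : z != s -> \forall w \near (z : K^o), w != s.
Proof.
move=> zs; have : 0 < `|z - s| by rewrite normr_gt0 subr_eq0.
move=> e0; near=> w.
have : `|z - w| < `|z - s| by near: w; exact: (@nbhsx_ballx _ K^o).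
by apply: contraTneq => ->; rewrite ltxx.
Unshelve. all: by end_near. Qed.

(* A pole of order [p] at [s] is encoded as [g z / (z - s) ^+ p], off [s], with
   [g] smooth at [s]. *)
Lemma polar_step (Z omega g W : K -> K) (c s : K) p :
  (\forall z \near (s : K^o), z != s -> Z z = g z / (z - s) ^+ p) ->
  (\forall z \near (s : K^o), z != s -> (z - s) * omega z = W z) ->
  smooth_at g s -> smooth_at W s ->
  exists2 h, smooth_at h s &
    h s = - (p%:R + c * W s) * g s /\
    \forall z \near (s : K^o), z != s ->
      derive1 (Z : K -> K^o) z - c * omega z * Z z = h z / (z - s) ^+ p.+1.
Proof.
move=> HZ HW sg sW.
have sid := smooth_at_id s; have scst b := smooth_at_cst b s.
(* The numerator over (z - s)^(p+1): the first two terms come from differentiating g / (z - s)^p,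
   the last from c omega Z with omega = W / (z - s). *)
pose h z := (z - s) * derive1 (g : K -> K^o) z - p%:R * g z - c * (W z * g z).
exists h.
  apply: smooth_atB.
    apply: smooth_atB; apply: smooth_atM => //; first exact: smooth_atB.
    exact: smooth_at_derive.
  by apply: smooth_atM => //; exact: smooth_atM.
split; first by rewrite /h subrr; ring.
have [dg _] := sg 1%N.
apply: nearS (near_and (near_join HZ) (near_and (near_and HZ HW) dg)) => z [HZ' [[{}HZ {}HW] dgz]] zs.
have zs0 : z - s != 0 by rewrite subr_eq0.
have omE : omega z = W z / (z - s) by rewrite -HW// mulrC mulKf.
have d1 : is_cderive (fun x => g x * ((x - s) ^+ p)^-1) z
    (derive1 (g : K -> K^o) z * ((z - s) ^+ p)^-1 +
     g z * (- (p%:R * (z - s) ^+ p.-1) * (((z - s) ^+ p)^-1 * ((z - s) ^+ p)^-1))).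
  apply: is_cderiveM => //; apply: is_cderiveV; first exact: is_cderive_subX.
  by rewrite expf_neq0.
(* The expression for Z is known only off s; as z != s, a small neighbourhood of z avoids s. *)
have d2 := is_cderive_near (g := Z) _ d1.
rewrite (is_cderiveE (d2 _)); last first.
  apply: nearS (near_and HZ' (near_neq zs)) => w [H ws].
  by rewrite H.
rewrite omE HZ// /h.
have pw : (z - s) ^+ p != 0 by rewrite expf_neq0.
case: p HZ' {HZ d1 d2} @h pw => [|p] _ h pw /=.
  by rewrite expr0 expr1; field.
rewrite !exprS in pw *.
have pw2 : (z - s) ^+ p != 0 by rewrite expf_neq0.
by field; rewrite zs0 pw2.
Qed.

End SmoothAt.

(** * The tangent at even and odd integers *)

Section Tangent.
Context {R : realType}.
Implicit Types (s z w : R[i]).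
Local Notation Re := (@complex.Re R).
Local Notation Im := (@complex.Im R).
Local Notation unit_itv := (`[0%R, 1%R]%classic : set (measurableTypeR R)).

(* [\int_0^1 e^(w u) du], which is [(e^w - 1) / w] continued to [w = 0] *)
Definition expm1_quotient w : R[i] := laplace unit_itv (fun=> 1) id 0 w.

Let hyp w (x : R) : Re w - 1 < x < Re w + 1 ->
  rintegrable unit_itv (fun t => (fun=> 1) t * expR (x * id t)).
Proof.
move=> _; apply: continuous_compact_integrable; first exact: segment_compact.
apply: continuous_subspaceT => t; apply: cvgM; first exact: cvg_cst.
apply: continuous_comp; last exact: continuous_expR.
by apply: cvgM; [exact: cvg_cst|exact: cvg_id].
Qed.

Lemma smooth_expm1_quotient w : smooth_at expm1_quotient w.
Proof.
have h : Re w - 1 < Re w < Re w + 1 by lra.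
exact: (smooth_laplace (measurable_itv _) (measurable_cst _) (@measurable_id _ _ _) (@hyp w) h).
Qed.

Lemma expm1_quotientM w : w * expm1_quotient w = cexp w - 1.
Proof.
have h : Re w - 1 < Re w < Re w + 1 by lra.
have i1 := laplace_integrable (measurable_itv _) (measurable_cst _) (@measurable_id _ _ _) (@hyp w) 0 h.
rewrite /expm1_quotient /laplace -cintegralZ//.
have E t : laplace_integrand (fun=> 1) id 0 w t = cexp (w * t%:C) :> R[i].
  by rewrite /laplace_integrand expr0 mulr1 mul1r.
have d t : is_rderive (fun x : R => cexp (w * x%:C)) t (w * cexp (w * t%:C)).
  by apply: is_rderive_eq (is_rderive_cexpM w (is_derive_id t 1)) _; rewrite mulr1.
rewrite (@cintegral_FTC _ (fun t : R => cexp (w * t%:C))).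
- by rewrite rmorph1 rmorph0 mulr1 mulr0 cexp0.
- exact: ltr01.
- by move=> t _; rewrite E.
- move=> t _; exists (w * (w * cexp (w * t%:C))).
  by under eq_fun do rewrite E; exact: is_rderiveZ.
Qed.

Lemma expm1_quotient0 : expm1_quotient 0 = 1.
Proof.
rewrite /expm1_quotient /laplace /laplace_integrand.
under eq_cintegral do rewrite expr0 mulr1 mul1r mul0r cexp0.
rewrite /cintegral !Rintegral_cst//=.
by rewrite lebesgue_measure_itv /= lte01 /= oppr0 addr0 mulr1 mul0r.
Qed.

Definition cispi z : R[i] := cexp ('i * pi%:C * z).

Lemma cispiD z w : cispi (z + w) = cispi z * cispi w.
Proof. by rewrite /cispi mulrDr cexpD. Qed.

Lemma cispi1 : cispi 1 = -1.
Proof.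
rewrite /cispi mulr1 iE; apply: complex_ext; rewrite /cexp !(cReM, cImM) /=.
  by rewrite !(mul0r, mulr0, mul1r, add0r, addr0, subr0) expR0 cospi; ring.
by rewrite !(mul0r, mulr0, mul1r, add0r, addr0, subr0) sinpi mulr0 oppr0.
Qed.

Lemma cispi_nat n : cispi n%:R = (-1) ^+ n.
Proof.
elim: n => [|n IH]; first by rewrite /cispi mulr0 cexp0.
by rewrite -[n.+1%:R]natr1 cispiD IH cispi1 exprSr.
Qed.

Lemma smooth_cispi s : smooth_at cispi s.
Proof.
apply: (@smooth_at_near _ (fun z => cexp ('i * pi%:C * z + 0))).
  by near=> z; rewrite addr0.
exact: smooth_at_affine (erefl _) (smooth_cexp _).
Unshelve. all: by end_near. Qed.

(** Makes the tangent a rational function of q = e^(i pi z), with q = 1 at even integers and q = -1,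
    the pole, at odd ones. *)
Lemma ctan_cispi z : ctan (pi%:C * z / 2) = - 'i * (cispi z - 1) / (cispi z + 1).
Proof.
rewrite /ctan /csin /ccos cexpN.
have -> : cispi z = cexp ('i * (pi%:C * z / 2)) ^+ 2.
  by rewrite expr2 -cexpD /cispi; congr cexp; field.
move: (cexp _) (cexp_neq0 ('i * (pi%:C * z / 2))) => e e0.
have -> : e - e^-1 = (e ^+ 2 - 1) / e by field.
have -> : e + e^-1 = (e ^+ 2 + 1) / e by field.
have i0 : 'i%R != 0 :> R[i] by rewrite iE eq_complex /= oner_eq0 andbF.
rewrite !invfM !invrK.
have -> : ('i%R)^-1 = - 'i%R :> R[i].
  by apply: (mulfI i0); rewrite mulfV// mulrN -expr2 sqrCi opprK.
(* With this inverse abstract the identity holds at the poles too, where both sides are 0. *)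
move: (_ ^+ 2 + 1)^-1 => u.
by field.
Qed.

Lemma smooth_ctan_even n : smooth_at (fun z => ctan (pi%:C * z / 2)) (2 * n)%N%:R.
Proof.
have q1 : cispi (2 * n)%N%:R = 1 by rewrite cispi_nat exprM sqrrN !expr1n.
have sq := smooth_cispi (2 * n)%N%:R.
apply: (@smooth_at_near _ (fun z => - 'i * (cispi z - 1) * (cispi z + 1)^-1)).
  by near=> z; rewrite ctan_cispi.
apply: smooth_atM.
  apply: smooth_atM; first exact: smooth_at_cst.
  by apply: smooth_atB => //; exact: smooth_at_cst.
apply: smooth_atV; last by rewrite q1 -(natrD _ 1 1) pnatr_eq0.
by apply: smooth_atD => //; exact: smooth_at_cst.
Unshelve. all: by end_near. Qed.

(** With v = i pi (z - s), e^(i pi z) = -e^v and the product is -(e^v + 1) / pi times v / (e^v - 1).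
    The last quotient is the inverse of [expm1_quotient], which is smooth and equals 1 at v = 0. *)
Lemma polar_ctan_odd n : exists2 h, smooth_at h (2 * n + 1)%N%:R &
  h (2 * n + 1)%N%:R = - 2 / pi%:C /\
  forall z : R[i], z != (2 * n + 1)%N%:R ->
    (z - (2 * n + 1)%N%:R) * ctan (pi%:C * z / 2) = h z.
Proof.
set s : R[i] := (2 * n + 1)%N%:R.
have q1 : cispi s = -1 by rewrite cispi_nat exprD exprM sqrrN !expr1n mul1r expr1.
have i0 : 'i%R != 0 :> R[i] by rewrite iE eq_complex /= oner_eq0 andbF.
have pi0 : pi%:C != 0 :> R[i] by rewrite fmorph_eq0 gt_eqF// pi_gt0.
(* The arguments have the shape a z + b expected by [smooth_at_affine]. *)
pose h z := - (pi%:C)^-1 * (cispi (1 * z + - s) + 1) * (expm1_quotient ('i * pi%:C * z + - ('i * pi%:C * s)))^-1.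
have e0 : 'i * pi%:C * s + - ('i * pi%:C * s) = 0 by rewrite subrr.
exists h.
  apply: smooth_atM.
    apply: smooth_atM; first exact: smooth_at_cst.
    apply: smooth_atD; last exact: smooth_at_cst.
    exact: smooth_at_affine (erefl _) (smooth_cispi _).
  apply: smooth_atV; last by rewrite e0 expm1_quotient0 oner_eq0.
  exact: smooth_at_affine (erefl _) (smooth_expm1_quotient _).
split.
  rewrite /h e0 expm1_quotient0 mul1r subrr (cispi_nat 0) expr0 invr1 mulr1.
  by move: (pi%:C) pi0 => p p0; field.
move=> z zs; rewrite ctan_cispi /h.
have zs0 : z - s != 0 by rewrite subr_eq0.
set v := 'i * pi%:C * z + _.
have vE : v = 'i * pi%:C * (z - s) by rewrite /v mulrBr.
have v0 : v != 0 by rewrite vE !mulf_neq0.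
have -> : cispi z = - cexp v by rewrite -{1}(subrK s z) cispiD q1 mulrN1 /cispi vE.
have -> : cispi (1 * z + - s) = cexp v by rewrite mul1r vE.
have -> : expm1_quotient v = (cexp v - 1) / v by rewrite -expm1_quotientM mulrC mulKf.
have -> : z - s = v / ('i * pi%:C) by rewrite vE mulrC mulKf// mulf_neq0.
rewrite !invfM !invrK (_ : - cexp v + 1 = - (cexp v - 1)); last by ring.
rewrite invrN; move: (_ - 1)^-1 => u.
by move: (pi%:C) pi0 => p p0; field; rewrite i0 p0.
Qed.

End Tangent.

(** * Expansions of omega and Z_k, and the limits of xi_k *)

Section ZFunctions.
Context {R : realType}.
Implicit Types (s z w : R[i]).
Local Notation Re := (@complex.Re R).
Local Notation Im := (@complex.Im R).
Local Notation normc := (@ComplexField.Normc.normc R).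

Lemma near_Re s (e : R) : 0 < e -> \forall z \near (s : R[i]^o), `|Re z - Re s| < e.
Proof.
move=> e0; have e0' : 0 < e%:C by rewrite ltcR.
near=> z.
have : `|s - z| < e%:C by near: z; exact: (@nbhsx_ballx _ R[i]^o).
rewrite normE ltcR => h; rewrite distrC; apply: le_lt_trans h.
by have := normc_Re (s - z); rewrite cReD cReN.
Unshelve. all: by end_near. Qed.

Lemma near_Re_gt0 s : 0 < Re s -> \forall z \near (s : R[i]^o), 0 < Re z.
Proof.
by move=> s0; apply: nearS (near_Re s s0) => z; rewrite ltr_norml; lra.
Qed.

Lemma smooth_Gamma s : 0 < Re s -> smooth_at (@Gamma R) s.
Proof.
move=> s0; apply: smooth_at_near (smooth_Gamma_right s0).
by apply: nearS (near_Re_gt0 s0) => z z0; rewrite Gamma_rightE.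
Qed.

Lemma Gamma_nat_neq0 n : Gamma n.+1%:R != 0 :> R[i].
Proof.
by rewrite Gamma_rightE ?cRe_nat// Gamma_right_nat pnatr_eq0 -lt0n fact_gt0.
Qed.

Definition digamma_part z : R[i] := (ln (2 * pi))%:C - cderiv Gamma z / Gamma z.

Lemma smooth_digamma_part n : smooth_at digamma_part n.+1%:R.
Proof.
have s0 : 0 < Re n.+1%:R by rewrite cRe_nat.
apply: smooth_atB; first exact: smooth_at_cst.
apply: smooth_atM; first exact: smooth_at_derive (smooth_Gamma s0).
by apply: smooth_atV; [exact: smooth_Gamma|exact: Gamma_nat_neq0].
Qed.

Lemma smooth_omega_even n : smooth_at (@omega R) (2 * n.+1)%N%:R.
Proof.
apply: smooth_atD.
  by rewrite mulnS; exact: smooth_digamma_part.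
by apply: smooth_atM; [exact: smooth_at_cst|exact: smooth_ctan_even].
Qed.

Lemma polar_omega_odd n : exists2 W, smooth_at W (2 * n + 1)%N%:R &
  W (2 * n + 1)%N%:R = -1 /\
  forall z : R[i], z != (2 * n + 1)%N%:R -> (z - (2 * n + 1)%N%:R) * omega z = W z.
Proof.
have [h sh [h0 hz]] := @polar_ctan_odd R n.
have pi0 : pi%:C != 0 :> R[i] by rewrite fmorph_eq0 gt_eqF// pi_gt0.
set s : R[i] := _%:R in sh h0 hz *.
exists (fun z => (z - s) * digamma_part z + pi%:C / 2 * h z).
  apply: smooth_atD; last by apply: smooth_atM => //; exact: smooth_at_cst.
  apply: smooth_atM; last by rewrite /s addn1; exact: smooth_digamma_part.
  by apply: smooth_atB; [exact: smooth_at_id|exact: smooth_at_cst].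
split.
  by rewrite subrr mul0r add0r h0; move: (pi%:C) pi0 => p p0; field.
by move=> z zs; rewrite /omega -/(digamma_part z) mulrDr -hz//; ring.
Qed.

Lemma smooth_zeta s : 0 < Re s -> s != 1 -> smooth_at (@zeta R) s.
Proof.
move=> s0 s1.
apply: (@smooth_at_near _ (fun z => z * (z - 1)^-1 - z * cintegral `[1, +oo[%classic (zeta_integrand z))).
  by apply: nearS (near_Re_gt0 s0) => z z0; rewrite zetaE.
have sid := @smooth_at_id _ s.
apply: smooth_atB; apply: smooth_atM => //; last exact: smooth_zeta_integral.
apply: smooth_atV; last by rewrite subr_eq0.
by apply: smooth_atB => //; exact: smooth_at_cst.
Qed.

Lemma smooth_Z_even k n : smooth_at (@Z R k) (2 * n.+1)%N%:R.
Proof.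
elim: k => [|k IH].
  by apply: smooth_zeta; rewrite ?cRe_nat ?ltr0n// (eqr_nat _ _ 1) mulnS.
apply: smooth_atB; first exact: smooth_at_derive.
apply: smooth_atM => //; apply: smooth_atM; first exact: smooth_at_cst.
exact: smooth_omega_even.
Qed.

(* [m] is the order of the pole of [zeta] at the point: 1 at [s = 1], 0 at the
   other odd points. *)
Lemma polar_Z_odd k n m (g0 : R[i] -> R[i]) : smooth_at g0 (2 * n + 1)%N%:R ->
  (\forall z \near ((2 * n + 1)%N%:R : R[i]^o), z != (2 * n + 1)%N%:R ->
     zeta z = g0 z / (z - (2 * n + 1)%N%:R) ^+ m) ->
  exists2 g, smooth_at g (2 * n + 1)%N%:R &
    g (2 * n + 1)%N%:R = g0 (2 * n + 1)%N%:R * \prod_(j < k) (2^-1 - (m + j)%N%:R) /\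
    \forall z \near ((2 * n + 1)%N%:R : R[i]^o), z != (2 * n + 1)%N%:R ->
      Z k z = g z / (z - (2 * n + 1)%N%:R) ^+ (m + k).
Proof.
have [W sW [W0 Wz]] := polar_omega_odd n.
set s : R[i] := _%:R in sW W0 Wz * => sg0 Hz.
elim: k => [|k [g sg [g1 g2]]].
  by exists g0 => //; rewrite big_ord0 mulr1 addn0.
have HW : \forall z \near (s : R[i]^o), z != s -> (z - s) * omega z = W z.
  by near=> z; exact: Wz.
have [h sh [h1 h2]] := polar_step (2^-1) g2 HW sg sW.
exists h => //; split; last by rewrite addnS.
by rewrite h1 W0 g1 big_ord_recr /=; ring.
Unshelve. all: by end_near. Qed.

End ZFunctions.

(** * Evaluation of the limits defining [xi] *)

Section Limits.
Context {R : realType}.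
Implicit Types (s z w : R[i]).
Local Notation Re := (@complex.Re R).
Local Notation Im := (@complex.Im R).
Local Notation normc := (@ComplexField.Normc.normc R).

Lemma xi_limit k s (f : R[i] -> R[i]) l :
  (\forall z \near (s : R[i]^o), z != s -> xi_formula k z = f z) ->
  smooth_at f s -> f s = l ->
  cvg (punctured (@xi_formula R k) s) /\ @xi R k s = l.
Proof.
move=> fz sf fl.
have h : punctured (@xi_formula R k) s --> (l : R[i]^o) by exact: smooth_at_cvg_punctured fz sf fl.
split; first by apply/cvg_ex; exists l.
exact: (cvg_lim (@norm_hausdorff _ R[i]^o) h).
Qed.

(** x^(k-1) without integer exponents, so that the smoothness rules for powers and inverses
    apply. *)
Definition pred_power (k : nat) (x : R[i]) : R[i] := if k is k'.+1 then x ^+ k' else x^-1.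

Lemma pred_powerE k x : x ^ (k%:Z - 1) = pred_power k x.
Proof.
case: k => [|k]; first by rewrite sub0r exprN1.
by rewrite (_ : k.+1%:Z - 1 = k)// -addn1 PoszD addrK.
Qed.

Lemma pred_power_div k x : x != 0 -> pred_power k x = x ^+ k / x.
Proof. by move=> x0; case: k => [|k] /=; rewrite ?div1r// exprSr mulfK. Qed.

Lemma smooth_pred_power k (f : R[i] -> R[i]) s : smooth_at f s -> f s != 0 ->
  smooth_at (fun z => pred_power k (f z)) s.
Proof. by move=> sf fs; case: k => [|k] /=; [exact: smooth_atV|exact: smooth_atX]. Qed.

Lemma Re_half z : Re (z / 2) = Re z / 2.
Proof. by rewrite (_ : z / 2 = z * (2^-1)%:C) ?cReMr// fmorphV rmorph_nat. Qed.

Lemma smooth_at_half (f : R[i] -> R[i]) s : smooth_at f (s / 2) -> smooth_at (fun z => f (z / 2)) s.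
Proof.
move=> sf; apply: (@smooth_at_near _ (fun z => f (2^-1 * z + 0))).
  by near=> z; rewrite addr0 mulrC.
by apply: smooth_at_affine sf; rewrite addr0 mulrC.
Unshelve. all: by end_near. Qed.

Lemma smooth_at_half_sub (f : R[i] -> R[i]) (c : R[i]) s : smooth_at f ((1 - s) / 2 + c) ->
  smooth_at (fun z => f ((1 - z) / 2 + c)) s.
Proof.
move=> sf; apply: (@smooth_at_near _ (fun z => f (- 2^-1 * z + (2^-1 + c)))).
  by near=> z; congr f; field.
by apply: smooth_at_affine sf; field.
Unshelve. all: by end_near. Qed.

Lemma smooth_cpow_half s : smooth_at (fun z => cpow pi (- z / 2) : R[i]) s.
Proof.
apply: (@smooth_at_near _ (fun z => cexp (- (2^-1 * (ln pi)%:C) * z + 0))).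
  by near=> z; rewrite /cpow; congr cexp; field.
exact: smooth_at_affine (erefl _) (smooth_cexp _).
Unshelve. all: by end_near. Qed.

Lemma cpowD (t : R) z w : cpow t (z + w) = cpow t z * cpow t w.
Proof. by rewrite /cpow mulrDl cexpD. Qed.

Lemma cpowNn (t : R) z k : cpow t (k%:R * z) = cpow t z ^+ k.
Proof.
elim: k => [|k IH]; first by rewrite mul0r /cpow mul0r cexp0.
by rewrite -[k.+1%:R]natr1 mulrDl mul1r cpowD IH exprSr.
Qed.

Lemma cpow_pi_half : cpow pi (- 2^-1) = ((Num.sqrt pi)%:C)^-1 :> R[i].
Proof.
have sp : 0 < Num.sqrt pi :> R by rewrite sqrtr_gt0 pi_gt0.
rewrite /cpow -[in ln _](@sqr_sqrtr R pi) ?pi_ge0// lnXn//.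
have -> : - 2^-1 * (ln (Num.sqrt pi) *+ 2)%:C = (- ln (Num.sqrt pi))%:C :> R[i].
  by rewrite rmorphMn rmorphN /= -mulr_natr; field.
by rewrite cexp_real expRN lnK// fmorphV.
Qed.

Lemma xi_even k n : let s := (2 * n.+1)%N%:R in
  cvg (punctured (@xi_formula R k) s) /\
  @xi R k s = (-1) ^+ (k * n.+1) * cpow pi (- ((2 * n.+1 + k)%N%:R / 2)) *
    ((2 * n.+1)%N%:R * (2 * n.+1 - 1)%N%:R) * (n`!)%:R *
    (((2 * n.+1)`!)%:R / (4 ^+ n.+1 * (n.+1`!)%:R * (n`!)%:R)) ^+ k * Z k s.
Proof.
move=> s.
(* G is Gamma((1 - z) / 2) computed with the fixed shift N near s = 2N. *)
pose N := n.+1; pose G z := Gamma_right ((1 - z) / 2 + N%:R) * (\prod_(j < N) ((1 - z) / 2 + j%:R))^-1.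
have sE : s = 2 * N%:R by rewrite /s natrM.
have s2 : s / 2 = N%:R by rewrite sE; field.
have s2' : (1 - s) / 2 = 2^-1 - N%:R by rewrite sE; field.
have nf : (n`!)%:R != 0 :> R[i] by rewrite pnatr_eq0 -lt0n fact_gt0.
have Nf : (N`!)%:R != 0 :> R[i] by rewrite pnatr_eq0 -lt0n fact_gt0.
have NNf : ((2 * N)`!)%:R != 0 :> R[i] by rewrite pnatr_eq0 -lt0n fact_gt0.
have f4 : 4 ^+ N != 0 :> R[i] by rewrite expf_neq0// pnatr_eq0.
have sp : (Num.sqrt pi)%:C != 0 :> R[i] by rewrite fmorph_eq0 gt_eqF// sqrtr_gt0 pi_gt0.
have sg : (-1) ^+ N != 0 :> R[i] by rewrite signr_eq0.
have G1 : Gamma_right (s / 2) = (n`!)%:R by rewrite s2 Gamma_right_nat.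
have pr : \prod_(j < N) ((1 - s) / 2 + j%:R) = (-1) ^+ N * ((2 * N)`!)%:R / (4 ^+ N * (N`!)%:R).
  by rewrite s2' prod_half_shift.
have pr0 : \prod_(j < N) ((1 - s) / 2 + j%:R) != 0.
  by rewrite pr !mulf_neq0 ?invr_eq0 ?mulf_neq0.
have G2 : G s = (Num.sqrt pi)%:C / \prod_(j < N) ((1 - s) / 2 + j%:R).
  by rewrite /G {1}s2' subrK Gamma_right_half.
have G20 : G s != 0 by rewrite G2 mulf_neq0// invr_eq0.
pose f z := cpow pi (- z / 2) * z * (z - 1) *
  (Z k z * (pred_power k (Gamma_right (z / 2)) * G z ^+ k)^-1).
have sG : smooth_at G s.
  apply: smooth_atM.
    apply: smooth_at_half_sub; apply: smooth_Gamma_right.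
    rewrite s2' subrK -[2%:R in X in 0 < X]/(2%:R : R[i]) natrC -fmorphV /=.
    by rewrite invr_gt0.
  apply: smooth_atV => //; apply: (@smooth_at_prod _ N (fun j z => (1 - z) / 2 + j%:R)) => j.
  exact: (@smooth_at_half_sub id j%:R s (@smooth_at_id _ _)).
have sG1 : smooth_at (fun z => Gamma_right (z / 2)) s.
  by apply: smooth_at_half; apply: smooth_Gamma_right; rewrite s2 cRe_nat.
apply: (@xi_limit k s f).
(* Within distance 1 of 2N, Re((1 - z) / 2) lies strictly between -N and 1 - N: adding N makes it
   positive, and adding any j < N leaves it negative, so no factor vanishes. *)
- apply: nearS (near_Re s (@ltr01 R)) => z zs _.
  have {}zs : `|Re z - 2 * N%:R| < 1 by move: zs; rewrite /s cRe_nat natrM.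
  have N1 : 1 <= N%:R :> R by rewrite ler1n.
  have wE : Re ((1 - z) / 2) = (1 - Re z) / 2 by rewrite Re_half cReD cReN.
  move: zs; rewrite ltr_norml => zs.
  rewrite /xi_formula /f pred_powerE Gamma_rightE; last by rewrite Re_half; lra.
  rewrite (@Gamma_shift _ _ N)//.
    by rewrite wE; lra.
  move=> j jN; apply: contra_neq (_ : Re ((1 - z) / 2 + j%:R) != 0).
    by move=> ->.
  rewrite cReD wE cRe_nat lt_eqF//.
  have : j%:R + 1 <= N%:R :> R by rewrite natr1 ler_nat.
  by lra.
- apply: smooth_atM.
    apply: smooth_atM; last by apply: smooth_atB; [exact: smooth_at_id|exact: smooth_at_cst].
    by apply: smooth_atM; [exact: smooth_cpow_half|exact: smooth_at_id].
  apply: smooth_atM; first exact: smooth_Z_even.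
  apply: smooth_atV.
    apply: smooth_atM; last exact: smooth_atX.
    by apply: smooth_pred_power; rewrite ?G1.
  rewrite mulf_neq0 ?expf_neq0// pred_power_div ?G1// mulf_neq0 ?expf_neq0// invr_eq0//.
- rewrite /f G1 pred_power_div// G2 pr.
  have -> : (2 * n.+1 - 1)%N%:R = s - 1 by rewrite natrB// muln_gt0.
  have -> : - s / 2 = - N%:R by rewrite mulNr s2.
  have -> : - ((2 * n.+1 + k)%N%:R / 2) = - N%:R + k%:R * (- 2^-1) :> R[i].
    by rewrite natrD natrM -/N; field.
  rewrite cpowD cpowNn cpow_pi_half -/N -/s (mulnC k) exprM.
  rewrite !(exprMn, exprVn).
  (* The sign arises in a denominator, from Gamma(1/2 - N), and is its own inverse. *)
  have -> : ((-1) ^+ N) ^+ k = (((-1) ^+ N) ^+ k)^-1 :> R[i].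
    by rewrite -exprVn; congr (_ ^+ _); rewrite -exprVn invrN1.
  have X0 (x : R[i]) : x != 0 -> x ^+ k != 0 by exact: expf_neq0.
  have := X0 _ nf; have := X0 _ Nf; have := X0 _ NNf; have := X0 _ f4; have := X0 _ sp; have := X0 _ sg.
  move: (_ ^+ k) (_ ^+ k) (_ ^+ k) (_ ^+ k) (_ ^+ k) (_ ^+ k) => a b c d e g a0 b0 c0 d0 e0 g0.
  by field; rewrite ?a0 ?b0 ?c0 ?d0 ?e0 ?g0 ?nf.
Qed.

(** The pair (q, m) treats all odd points at once: m = 1 and q = 1 at s = 1, where z - 1 removes the
    pole of zeta; m = 0 and q(z) = z - 1 elsewhere. B is Gamma(s / 2). *)
Lemma xi_odd_limit k n m (g0 q : R[i] -> R[i]) : let s := (2 * n + 1)%N%:R in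
  let B := ((2 * n)`!)%:R / (4 ^+ n * (n`!)%:R) * (Num.sqrt pi)%:C in
  smooth_at g0 s -> smooth_at q s ->
  (\forall z \near (s : R[i]^o), z != s -> zeta z = g0 z / (z - s) ^+ m) ->
  (forall z, z != s -> z - 1 = q z * (z - s) ^+ m) ->
  cvg (punctured (@xi_formula R k) s) /\
  @xi R k s = cpow pi (- s / 2) * s * q s *
    (g0 s * \prod_(j < k) (2^-1 - (m + j)%N%:R) * (- 2^-1 * ((-1) ^+ n * (n`!)%:R)) ^+ k * (B / B ^+ k)).
Proof.
move=> s B sg0 sq Hzeta Hq.
have [g sg [gs gz]] := @polar_Z_odd R k n m g0 sg0 Hzeta.
(* r(z) (z - s) is 1 / Gamma((1 - z) / 2) near s, off s: with the shift n + 1, the factor j = n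
   equals -(z - s) / 2, whence the zero and the constant -1/2. *)
pose r z := - 2^-1 * (\prod_(j < n) ((1 - z) / 2 + j%:R)) * (Gamma_right ((1 - z) / 2 + n.+1%:R))^-1.
have sE : s = 2 * n%:R + 1 by rewrite /s natrD natrM.
have s2 : s / 2 = 2^-1 + n%:R by rewrite sE; field.
have s2' : (1 - s) / 2 = - n%:R by rewrite sE; field.
have s2'' : (1 - s) / 2 + n.+1%:R = 1 by rewrite s2' -[n.+1%:R]natr1 addKr.
have nf : (n`!)%:R != 0 :> R[i] by rewrite pnatr_eq0 -lt0n fact_gt0.
have NNf : ((2 * n)`!)%:R != 0 :> R[i] by rewrite pnatr_eq0 -lt0n fact_gt0.
have f4 : 4 ^+ n != 0 :> R[i] by rewrite expf_neq0// pnatr_eq0.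
have sp : (Num.sqrt pi)%:C != 0 :> R[i] by rewrite fmorph_eq0 gt_eqF// sqrtr_gt0 pi_gt0.
have B0 : B != 0 by rewrite /B !mulf_neq0// invr_eq0 mulf_neq0.
have G1 : Gamma_right (s / 2) = B by rewrite s2 Gamma_right_half_nat.
have rs : r s = - 2^-1 * ((-1) ^+ n * (n`!)%:R).
  by rewrite /r s2'' Gamma_right1 s2' prod_nat_shift invr1 mulr1.
have sr : smooth_at r s.
  apply: smooth_atM.
    apply: smooth_atM; first exact: smooth_at_cst.
    apply: (@smooth_at_prod _ n (fun j z => (1 - z) / 2 + j%:R)) => j.
    exact: (@smooth_at_half_sub id j%:R s (@smooth_at_id _ _)).
  apply: smooth_atV; last by rewrite s2'' Gamma_right1 oner_eq0.
  by apply: smooth_at_half_sub; apply: smooth_Gamma_right; rewrite s2'' /= ltr01.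
have sG1 : smooth_at (fun z => Gamma_right (z / 2)) s.
  apply: smooth_at_half; apply: smooth_Gamma_right; rewrite Re_half cRe_nat.
  by rewrite divr_gt0// ltr0n addn1.
pose f z := cpow pi (- z / 2) * z * q z * (g z * r z ^+ k * (pred_power k (Gamma_right (z / 2)))^-1).
apply: (@xi_limit k s f).
- apply: nearS (near_and gz (near_Re s (@ltr01 R))) => z [{}gz zs'] zs.
  have {}zs' : `|Re z - (2 * n%:R + 1)| < 1 by move: zs'; rewrite /s cRe_nat natrD natrM.
  have N1 : 0 <= n%:R :> R by rewrite ler0n.
  have wE : Re ((1 - z) / 2) = (1 - Re z) / 2 by rewrite Re_half cReD cReN.
  move: zs'; rewrite ltr_norml => zs'.
  have d0 : z - s != 0 by rewrite subr_eq0.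
  have wn : (1 - z) / 2 + n%:R = - ((z - s) / 2) by rewrite sE; field.
  have GE : (Gamma ((1 - z) / 2))^-1 = r z * (z - s).
    rewrite (@Gamma_shift _ _ n.+1).
    - rewrite big_ord_recr /= wn invfM invrK /r; move: (Gamma_right _)^-1 => u.
      by move: (\prod_(_ < _) _) => p; field.
    - by rewrite wE -[n.+1%:R]natr1; lra.
    move=> j; rewrite ltnS leq_eqVlt => /predU1P[->|jn].
      by rewrite wn oppr_eq0 mulf_neq0// invr_eq0 pnatr_eq0.
    apply: contra_neq (_ : Re ((1 - z) / 2 + j%:R) != 0); first by move=> ->.
    rewrite cReD wE cRe_nat lt_eqF//.
    have : j%:R + 1 <= n%:R :> R by rewrite natr1 ler_nat.
    by lra.
  rewrite /xi_formula /f pred_powerE Gamma_rightE; last by rewrite Re_half; lra.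
  rewrite gz// Hq// [(pred_power _ _ * _)^-1]invfM -[(Gamma _ ^+ k)^-1]exprVn GE exprMn exprD.
  have dm : (z - s) ^+ m != 0 by rewrite expf_neq0.
  have dk : (z - s) ^+ k != 0 by rewrite expf_neq0.
  move: (pred_power _ _)^-1 ((z - s) ^+ m) ((z - s) ^+ k) dm dk => p a b a0 b0.
  by field; rewrite a0 b0.
- have pp : pred_power k B != 0.
    by rewrite pred_power_div// mulf_neq0 ?expf_neq0 ?invr_eq0.
  apply: smooth_atM.
    apply: smooth_atM => //.
    by apply: smooth_atM; [exact: smooth_cpow_half|exact: smooth_at_id].
  apply: smooth_atM; first by apply: smooth_atM => //; exact: smooth_atX.
  by apply: smooth_atV; [apply: smooth_pred_power|]; rewrite ?G1.
- rewrite /f G1 pred_power_div// gs rs invfM invrK.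
  by rewrite [_^-1 * B]mulrC.
Qed.

Lemma odd_dfactS (k : nat) : odd_dfact k.+1%:Z = odd_dfact k%:Z * (2 * k%:Z + 1).
Proof.
rewrite /odd_dfact big_nat_recr//= PoszM; congr (_ * _).
by rewrite mulnS subn1 /= PoszD PoszM addrC.
Qed.

(** Each recursion factor times a -1/2 from 1 / Gamma((1 - z) / 2) is (2j + 1) / 4. *)
Lemma prod_dfact1 k : \prod_(j < k) (2^-1 - (1 + j)%N%:R) * (- 2^-1) ^+ k =
  (odd_dfact k%:Z)%:~R / 4 ^+ k :> R[i].
Proof.
elim: k => [|k IH]; first by rewrite /odd_dfact big_ord0 big_geq// !expr0 mulr1 divr1.
rewrite odd_dfactS big_ord_recr [in LHS]/= intrM intrD intrM exprSr mulrACA IH exprSr.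
rewrite natrD -[(Posz k)%:~R]/(k%:R : R[i]).
by field; rewrite expf_neq0// pnatr_eq0.
Qed.

(** The factors are now (2j - 1) / 4. The one for j = 0 is negative and produces the sign; for k = 0
    the sign is compensated by (-3)!! = -1. *)
Lemma prod_dfact0 k : \prod_(j < k) (2^-1 - (0 + j)%N%:R) * (- 2^-1) ^+ k =
  - (odd_dfact (k%:Z - 1))%:~R / 4 ^+ k :> R[i].
Proof.
case: k => [|k].
  by rewrite big_ord0 !expr0 mulr1 sub0r divr1 -[odd_dfact _]/(-1 : int) rmorphN opprK.
rewrite (_ : k.+1%:Z - 1 = k); last by rewrite -addn1 PoszD addrK.
elim: k => [|k IH].
  by rewrite big_ord_recr big_ord0 /= /odd_dfact big_geq// !expr1 mul1r subr0; field.
rewrite odd_dfactS big_ord_recr [in LHS]/= intrM intrD intrM exprSr mulrACA IH [4 ^+ k.+2]exprSr.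
rewrite add0n -[(Posz k)%:~R]/(k%:R : R[i]) -[k.+1%:R]natr1.
by field; rewrite expf_neq0// pnatr_eq0.
Qed.

Lemma xi_one k : cvg (punctured (@xi_formula R k) 1) /\
  @xi R k 1 = (odd_dfact k%:Z)%:~R / (4 * (Num.sqrt pi)%:C) ^+ k.
Proof.
pose J z := cintegral `[1%R, +oo[%classic (zeta_integrand z) : R[i].
(* This is (z - 1) zeta(z), continued to z = 1 by [zetaE]; its value 1 there is the residue of
   zeta. *)
pose g0 z := z - (z - 1) * (z * J z).
have E1 : (2 * 0 + 1)%N%:R = 1 :> R[i] by [].
have sid := @smooth_at_id R[i] 1.
have H0 : 0 < Re 1 by [].
have s1 : smooth_at g0 1.
  apply: smooth_atB => //; apply: smooth_atM.
    by apply: smooth_atB => //; exact: smooth_at_cst.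
  by apply: smooth_atM => //; exact: smooth_zeta_integral.
have h1 : \forall z \near (1 : R[i]^o), z != 1 -> zeta z = g0 z / (z - 1) ^+ 1.
  apply: nearS (near_Re_gt0 H0) => z z0 z1.
  by rewrite zetaE// /g0 -/(J z); field; rewrite subr_eq0.
have h2 z : z != 1 -> z - 1 = (fun=> 1) z * (z - 1) ^+ 1 by rewrite mul1r.
have [c ->] := @xi_odd_limit k 0 1 g0 (fun=> 1) s1 (smooth_at_cst _ _) h1 h2.
split; first exact: c.
have sp : (Num.sqrt pi)%:C != 0 :> R[i] by rewrite fmorph_eq0 gt_eqF// sqrtr_gt0 pi_gt0.
rewrite E1 !expr0 !(mul1r, mulr1, invr1) mulN1r cpow_pi_half.
rewrite /g0 subrr mul0r subr0 mul1r mulrA prod_dfact1 exprMn.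
have f4 : 4 ^+ k != 0 :> R[i] by rewrite expf_neq0// pnatr_eq0.
have spk : (Num.sqrt pi)%:C ^+ k != 0 :> R[i] by rewrite expf_neq0.
move: ((Num.sqrt pi)%:C) (4 ^+ k) ((Num.sqrt pi)%:C ^+ k) f4 sp spk => b d a d0 b0 a0.
by field; rewrite a0 b0 d0.
Qed.

Lemma xi_odd k n : let s := (2 * n.+1 + 1)%N%:R in
  cvg (punctured (@xi_formula R k) s) /\
  @xi R k s = (-1) ^+ (k * n.+1 + 1) * cpow pi (- ((2 * n.+1 + k)%N%:R / 2)) *
    (((2 * n.+1 + 1)`!)%:R * (2 * n.+1)%N%:R / (4 ^+ n.+1 * (n.+1`!)%:R)) *
    (4 ^+ n * (n.+1`!)%:R ^+ 2 / ((2 * n.+1)`!)%:R) ^+ k *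
    (odd_dfact (k%:Z - 1))%:~R * zeta s.
Proof.
move=> s; pose N := n.+1.
have sE : s = 2 * N%:R + 1 by rewrite /s natrD natrM.
have sz : smooth_at (@zeta R) s.
  by apply: smooth_zeta; rewrite ?cRe_nat ?ltr0n ?addn1// (eqr_nat _ _ 1) mulnS.
have h1 : \forall z \near (s : R[i]^o), z != s -> zeta z = zeta z / (z - s) ^+ 0.
  by near=> z; rewrite expr0 divr1.
have h2 z : z != s -> z - 1 = (fun z => z - 1) z * (z - s) ^+ 0 by rewrite expr0 mulr1.
have sq : smooth_at (fun z => z - 1) s by apply: smooth_atB; [exact: smooth_at_id|exact: smooth_at_cst].
have [c ->] := @xi_odd_limit k N 0 (@zeta R) (fun z => z - 1) sz sq h1 h2.
split; first exact: c.
rewrite -/s.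
have nf : (N`!)%:R != 0 :> R[i] by rewrite pnatr_eq0 -lt0n fact_gt0.
have NNf : ((2 * N)`!)%:R != 0 :> R[i] by rewrite pnatr_eq0 -lt0n fact_gt0.
have f4 : 4 ^+ n != 0 :> R[i] by rewrite expf_neq0// pnatr_eq0.
have sp : (Num.sqrt pi)%:C != 0 :> R[i] by rewrite fmorph_eq0 gt_eqF// sqrtr_gt0 pi_gt0.
(* Splits off pi^(-1/2), which cancels the square root of pi in the single factor B not raised to
   the power k. *)
have -> : - s / 2 = - N%:R + - 2^-1 by rewrite sE; field.
have -> : - ((2 * n.+1 + k)%N%:R / 2) = - N%:R + k%:R * (- 2^-1) :> R[i].
  by rewrite natrD natrM -/N; field.
rewrite !cpowD cpowNn cpow_pi_half -/N.
have -> : ((2 * N + 1)`!)%:R = s * ((2 * N)`!)%:R :> R[i].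
  by rewrite addn1 factS natrM /s addn1.
have -> : s - 1 = (2 * N)%N%:R by rewrite sE natrM addrK.
rewrite exprD expr1 (mulnC k) exprM [4 ^+ N]exprS.
have P := prod_dfact0 k.
rewrite [(- 2^-1 * _) ^+ k]exprMn [_ * (_ * _ ^+ k)]mulrA -[_ * _ * (- 2^-1) ^+ k]mulrA P.
rewrite !(exprMn, exprVn).
have X0 (x : R[i]) : x != 0 -> x ^+ k != 0 by exact: expf_neq0.
have := X0 _ nf; have := X0 _ NNf; have := X0 _ f4; have := X0 _ sp.
have k4 : (4 : R[i]) ^+ k != 0 by apply: X0; rewrite pnatr_eq0.
move: ((N`!)%:R ^+ k) (((2 * N)`!)%:R ^+ k) ((4 ^+ n) ^+ k) ((Num.sqrt pi)%:C ^+ k) (4 ^+ k) k4 => a b d e g g0 e0 d0 b0 a0.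
move: (_%:~R) (zeta s) (cpow _ _) (((-1) ^+ N) ^+ k) => t u v w.
move: ((Num.sqrt pi)%:C) sp ((N`!)%:R) nf ((2 * N)`!)%:R NNf (4 ^+ n) f4 => h h0 i i0 j j0 l l0.
by field; rewrite ?a0 ?b0 ?d0 ?e0 ?g0 ?h0 ?i0 ?j0 ?l0.
Unshelve. all: by end_near. Qed.

End Limits.

Theorem theorem6p1 (R : realType) (k : nat) :
  (cvg (punctured (@xi_formula R k) 1) /\
   @xi R k 1 = (odd_dfact k%:Z)%:~R / (4 * (Num.sqrt pi)%:C) ^+ k) /\
  (forall n : nat, (1 <= n)%N ->
    (cvg (punctured (@xi_formula R k) (2 * n + 1)%N%:R) /\
     @xi R k (2 * n + 1)%N%:R =
       (-1) ^+ (k * n + 1) * cpow pi (- ((2 * n + k)%N%:R / 2)) *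
       (((2 * n + 1)`!)%:R * (2 * n)%N%:R / (4 ^+ n * (n`!)%:R)) *
       (4 ^+ n.-1 * (n`!)%:R ^+ 2 / ((2 * n)`!)%:R) ^+ k *
       (odd_dfact (k%:Z - 1))%:~R * zeta (2 * n + 1)%N%:R) /\
    (cvg (punctured (@xi_formula R k) (2 * n)%N%:R) /\
     @xi R k (2 * n)%N%:R =
       (-1) ^+ (k * n) * cpow pi (- ((2 * n + k)%N%:R / 2)) *
       ((2 * n)%N%:R * (2 * n - 1)%N%:R) * ((n.-1)`!)%:R *
       (((2 * n)`!)%:R / (4 ^+ n * (n`!)%:R * ((n.-1)`!)%:R)) ^+ k *
       Z k (2 * n)%N%:R)).
Proof.
split; first exact: xi_one.
by case=> [//|n] _; split; [exact: xi_odd|exact: xi_even].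
Qed.
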